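(* Let $N,P\in\mathbb{N}$, let $\sigma=(\sigma_1,\dots,\sigma_P)\in\mathbb{R}^{N\times P}$ (with columns $\sigma_i\in\mathbb{R}^N$), and let $\mu$ be a nonnegative symmetric Radon measure on $\mathbb{R}^N\setminus\{0\}$ satisfying $\int_{|z|>0}\min\{|z|^2,1\}\,\mathrm{d}\mu(z)<\infty$. Assume that either $\sigma\not\equiv0$ or $\operatorname{supp}\mu\neq\emptyset$. If $v\in C_0(\mathbb{R}^N)$ satisfies $\mathfrak{L}^{\sigma,\mu}[v]=0$ in $\mathcal{D}'(\mathbb{R}^N)$, i.e. $\int_{\mathbb{R}^N}v\,\mathfrak{L}^{\sigma,\mu}[\psi]\,\mathrm{d}x=0$ for all $\psi\in C_c^\infty(\mathbb{R}^N)$, then $v\equiv0$ on $\mathbb{R}^N$.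
   Context: $C_0(\mathbb{R}^N)$ denotes the continuous functions on $\mathbb{R}^N$ vanishing at infinity. For $\psi\in C_c^\infty(\mathbb{R}^N)$ the operator is $\mathfrak{L}^{\sigma,\mu}[\psi]:=L^\sigma[\psi]+\mathcal{L}^\mu[\psi]$, where $L^\sigma[\psi](x):=\mathrm{tr}(\sigma\sigma^T D^2\psi(x))=\sum_{i=1}^P(\sigma_i\cdot D)^2\psi(x)$ and $\mathcal{L}^\mu[\psi](x):=\int_{\mathbb{R}^N\setminus\{0\}}\big(\psi(x+z)-\psi(x)-z\cdot D\psi(x)\mathbf{1}_{|z|\le 1}\big)\,\mathrm{d}\mu(z)$. *)

(* Defs.v *)
From HB Require Import structures.
From mathcomp Require Import all_boot all_order all_algebra.
From mathcomp Require Import all_classical all_reals all_analysis.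
Set Implicit Arguments. Unset Strict Implicit. Unset Printing Implicit Defensive.
Import Order.TTheory GRing.Theory Num.Theory.
Import numFieldNormedType.Exports.
Local Open Scope classical_set_scope.
Local Open Scope ring_scope.

Section Defs.
Variables (R : realType) (N : nat).

(* Euclidean norm |z| on R^N = 'rV[R]_N (the library norm on matrices is the
   sup norm, so we define the Euclidean one explicitly). *)
Definition enorm (z : 'rV[R]_N) : R := Num.sqrt (\sum_(i < N) z ord0 i ^+ 2).

Definition borelRV := g_sigma_algebraType (@open 'rV[R]_N).

Definition ebasis (i : 'I_N) : 'rV[R]_N := delta_mx ord0 i.
Definition partial (i : 'I_N) (f : 'rV[R]_N -> R) : 'rV[R]_N -> R :=
  fun x => derive f x (ebasis i).
Definition iter_partial (s : seq 'I_N) (f : 'rV[R]_N -> R) :=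
  foldr partial f s.

Definition smooth (f : 'rV[R]_N -> R) : Prop :=
  forall s : seq 'I_N, continuous (iter_partial s f) /\
    forall (i : 'I_N) (x : 'rV[R]_N), derivable (iter_partial s f) x (ebasis i).

Definition Cc_inf (f : 'rV[R]_N -> R) : Prop :=
  smooth f /\ compact (closure [set x | f x != 0]).

Definition C0 (f : 'rV[R]_N -> R) : Prop :=
  continuous f /\
  forall eps : R, 0 < eps -> exists M : R, forall x, M < enorm x -> `|f x| < eps.

(* Integral over R^N w.r.t. N-dimensional Lebesgue measure, written as the
   iterated integral of one-dimensional Lebesgue integrals (Fubini). *)
Definition upd (x : 'rV[R]_N) (m : nat) (t : R) : 'rV[R]_N :=
  \row_j (if (j : nat) == m then t else x ord0 j).
Fixpoint iint (n : nat) (g : 'rV[R]_N -> R) (x : 'rV[R]_N) : R :=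
  match n with
  | 0 => g x
  | m.+1 => Rintegral (@lebesgue_measure R) setT (fun t => iint m g (upd x m t))
  end.
Definition intRN (g : 'rV[R]_N -> R) : R := iint N g 0.

Definition Lsigma (P : nat) (sigma : 'M[R]_(N, P)) (psi : 'rV[R]_N -> R)
  (x : 'rV[R]_N) : R :=
  \sum_(i < P) derive (fun y => derive psi y (col i sigma)^T) x (col i sigma)^T.

Definition Lmu (mu : {measure set borelRV -> \bar R}) (psi : 'rV[R]_N -> R)
  (x : 'rV[R]_N) : R :=
  Rintegral mu (~` [set (0 : 'rV[R]_N)])
    (fun z : borelRV => psi (x + z) - psi x
        - derive psi x (z : 'rV[R]_N) * (if enorm z <= 1 then 1 else 0)).

Definition Lop (P : nat) (sigma : 'M[R]_(N, P)) (mu : {measure set borelRV -> \bar R})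
  (psi : 'rV[R]_N -> R) (x : 'rV[R]_N) : R :=
  Lsigma sigma psi x + Lmu mu psi x.

Definition msupport (mu : {measure set borelRV -> \bar R}) : set 'rV[R]_N :=
  [set x | x != 0 /\ forall U : set 'rV[R]_N, open U -> U x -> (0 < mu U)%E].

End Defs.

(* Main.v *)
Require Import Defs.
From HB Require Import structures.
From mathcomp Require Import all_boot all_order all_algebra.
From mathcomp Require Import all_classical all_reals all_analysis.
From mathcomp Require Import measurable_realfun ring lra.
Import Order.TTheory GRing.Theory Num.Theory.
Import numFieldNormedType.Exports.
Local Open Scope classical_set_scope.
Local Open Scope ring_scope.

(* Mollify: with rho_x a smooth bump centered at x, u(x) := int v rho_x is
   continuous, vanishes at infinity, and the equation tested against rho_x is a
   pointwise equation for u, which can be written with second differences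
   D_z u(x) = u(x + z) + u(x - z) - 2 u(x) only: the symmetry of mu removes the
   gradient from the jump part, which becomes 1/2 int D_z u(x) dmu(z) after
   Fubini, and the local part is the limit of h^-2 sum_i D_(h sigma_i) u(x).

   If u were positive somewhere, u + eps * min(|x|^2, K), for K large and eps
   small, would attain its maximum at some x0 in the ball where u is not small.
   There D_z u(x0) <= - eps * D_z min(|.|^2, K)(x0) <= - eps * min(2 |z|^2, 1)
   for every z, which makes both parts of the operator nonpositive, and one of
   them negative unless sigma = 0 and supp mu is empty.  Hence u <= 0, likewise
   - u <= 0, and v = 0 because the width of the bump is arbitrary. *)

Set Implicit Arguments.
Unset Strict Implicit.
Unset Printing Implicit Defensive.

(** * A smooth bump on the line *)

Section Bump.
Context {R : realType}.
Implicit Types (s t C : R) (k : nat).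

(** Second differences are what lets the weak equation pass to u: [molli_shift] transfers a shift of
    the test function's argument to its centre, so u is never differentiated and the local part
    enters only through an error bound of order h^3. The obstacle is integration. [intRN] is an
    iterated one-dimensional integral and [Rintegral] returns a default value on divergence, so
    linearity, monotonicity and Fubini have to be justified at every level; moreover the jump
    operator spreads a compactly supported test function over the whole space. Domination by
    boundedly many cubes of fixed width, weighted by min(|z|^2, 1), handles both: the cubes may move
    with z, but their total volume does not grow. A bump that is a product over coordinates fits
    these cubes and reduces its derivatives to one variable. The penalty is truncated because |x|^2
    is unbounded; at points with 2|x|^2 + 1 <= K the truncation still leaves second differences of
    size min(2|z|^2, 1), which is comparable to the weight that mu integrates. *)

Lemma is_derive_sq (f : R -> R) (x C : R) :
  (forall h, `|f (h + x) - f x| <= C * h ^+ 2) -> is_derive x (1 : R) f 0.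
Proof.
move=> fC.
have C0 : 0 <= C.
  by have := fC 1; rewrite expr1n mulr1; apply: le_trans.
have cv : h^-1 *: ((f \o shift x) (h *: (1:R)) - f x) @[h --> 0^'] --> (0 : R).
  apply/cvgr0Pnorm_lt => e e0.
  near=> h.
  have h0 : h != 0 by near: h; exact: nbhs_dnbhs_neq.
  rewrite normrZ /= [h *: 1]mulr1 normfV mulrC ltr_pdivrMr ?normr_gt0//.
  apply: le_lt_trans (fC h) _.
  rewrite -real_normK ?num_real// expr2 mulrA ltr_pM2r ?normr_gt0//.
  have hh : `|h| < e / (C + 1).
    near: h; apply: dnbhs0_lt; rewrite divr_gt0//; lra.
  have : C * `|h| <= (C + 1) * `|h| by apply: ler_wpM2r => //; lra.
  move=> /le_lt_trans; apply.
  by rewrite mulrC -ltr_pdivlMr//; lra.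
apply: DeriveDef.
- by apply/cvg_ex; exists 0.
- by apply: cvg_lim.
Unshelve. all: by end_near. Qed.

(** The exponent is a parameter because differentiating exp(-1/s) produces powers of 1/s: the linear
    span of this family is closed under differentiation. *)
Definition expinv k s := if 0 < s then s^-1 ^+ k * expR (- s^-1) else 0.

Lemma expinv0 k s : s <= 0 -> expinv k s = 0.
Proof. by rewrite /expinv; case: ltP. Qed.

Lemma expinvM k s : expinv k s = s * expinv k.+1 s.
Proof.
rewrite /expinv; case: ifP => [s0|_]; last by rewrite mulr0.
by rewrite exprS !mulrA mulfV ?gt_eqF// mul1r.
Qed.

(** exp(1/s) exceeds its Taylor term of order k + 2, which leaves two spare powers of s: the
    quadratic flatness that [is_derive_sq] turns into a zero derivative at the gluing point s =
    0. *)
Lemma expinv_le k s : `|expinv k s| <= (k.+2)`!%:R * s ^+ 2.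
Proof.
rewrite /expinv; case: ifP => s0; last first.
  by rewrite normr0 mulr_ge0// sqr_ge0.
have si : 0 < s^-1 by rewrite invr_gt0.
rewrite ger0_norm; last by rewrite mulr_ge0 ?expR_ge0 ?exprn_ge0 ?(ltW si).
have : s^-1 ^+ k.+2 / (k.+2)`!%:R <= expR s^-1.
  by apply: le_trans (expR_ge1Dxn k.+1 (ltW si)); rewrite lerDr.
rewrite ler_pdivrMr ?ltr0n ?fact_gt0// => H.
have -> : s^-1 ^+ k * expR (- s^-1) = s^-1 ^+ k.+2 / expR s^-1 * s ^+ 2.
  rewrite expRN [in RHS]exprSr exprSr. 
  have : s != 0 by rewrite gt_eqF. 
  by move: (expR_eq0 s^-1) => + ?; move/negbT => ?; field; apply/andP.
rewrite ler_pM2r ?exprn_gt0// ler_pdivrMr ?expR_gt0//.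
by rewrite mulrC.
Qed.

Lemma is_derive_expinv k s :
  is_derive s (1 : R) (expinv k) (expinv k.+2 s - k%:R * expinv k.+1 s).
Proof.
case: (ltrgtP s 0) => [s0|s0|->].
- rewrite !expinv0 ?(ltW s0)// mulr0 subrr.
  apply: near_eq_is_derive (is_derive_cst (0:R) s (1:R)) => //.
    near=> x; rewrite expinv0//; apply: ltW; near: x; exact: lt_nbhsl.
- have H : is_derive s (1:R) (fun x => (x^-1) ^+ k * expR (- x^-1))
     (expinv k.+2 s - k%:R * expinv k.+1 s).
    have sn : s != 0 by rewrite gt_eqF.
    have dV : is_derive s (1:R) (fun x : R => x^-1) (- s ^- 2).
      apply: is_derive_eq; first exact: is_deriveV.
      by rewrite /GRing.scale /= mulr1.
    have dE : is_derive s (1:R) (fun x => expR (- x^-1)) (expR (- s^-1) * s^-2).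
      have dVn : is_derive s (1:R) (fun x : R => - x^-1) (s ^- 2).
        by rewrite -[s^-2]opprK; apply: is_deriveN.
      exact: (@is_derive1_comp _ (@expR R) (fun x : R => - x^-1) s _ _ (is_derive_expR (- s^-1)) dVn).
    have dX : is_derive s (1:R) (fun x : R => x^-1 ^+ k) (k%:R * s^-1 ^+ k.-1 * - s ^- 2).
      have -> : (fun x : R => x^-1 ^+ k) = (@GRing.inv R : R -> R) ^+ k.
        by apply/funext => x; rewrite !fctE.
      have /is_derive_eq := @is_deriveX R R (@GRing.inv R) k s 1 _ dV; apply.
      by rewrite /GRing.scale /= -mulr_natl; ring.
    have /is_derive_eq := @is_deriveM R R _ _ s 1 _ _ dX dE; apply.
    rewrite /expinv s0 /GRing.scale /=.
    case: k {dX} => [|k] /=; rewrite !exprS ?expr0; field => //.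
  apply: near_eq_is_derive H => //.
  near=> x; rewrite /expinv ifT//; near: x; exact: lt_nbhsr.
- rewrite !expinv0// mulr0 subrr.
  apply: (@is_derive_sq _ _ (k.+2)`!%:R) => h.
  by rewrite addr0 (@expinv0 k 0)// subr0; exact: expinv_le.
Unshelve. all: by end_near. Qed.

(** With s = 1 - t^2 and E j for [expinv j s], differentiating p * E (2k) gives terms in E (2k), E
    (2k+1) and E (2k+2); by [expinvM] the first two are s^2 and s times the last, and this is the
    polynomial coefficient that results. *)
Fixpoint bump_poly k : {poly R} :=
  if k is k'.+1 then
    (bump_poly k')^`() * (1 - 'X^2) ^+ 2
    - bump_poly k' * 'X *+ 2 * (1 - (1 - 'X^2) *+ (k'.*2))
  else 1.

(* [bump k] is the [k]-th derivative of [exp (- 1 / (1 - t ^ 2))]. *)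
Definition bump k t := (bump_poly k).[t] * expinv k.*2 (1 - t ^+ 2).

Lemma is_derive_bump k t : is_derive t (1 : R) (bump k) (bump k.+1 t).
Proof.
have d1 : is_derive t (1:R) (fun x : R => 1 - x ^+ 2) (- (2 * t)).
  have -> : (fun x : R => 1 - x ^+ 2) = cst 1 - (@id R) ^+ 2.
    by apply/funext => x; rewrite !fctE.
  by apply: is_derive_eq; rewrite sub0r /GRing.scale /= mulr1 expr1 mulr_natl.
have d2 := @is_derive1_comp _ (expinv k.*2) _ t _ _ (is_derive_expinv k.*2 _) d1.
apply: is_derive_eq.
rewrite /bump /GRing.scale /=.
rewrite !(hornerE, hornerMn, horner_exp).
rewrite doubleS (expinvM k.*2) (expinvM k.*2.+1) /= -[(1 - t ^+ 2) *+ _]mulr_natl.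
move: (expinv k.*2.+2 _) => a.
move: (bump_poly k)^`().[t] => b.
move: (bump_poly k).[t] => c.
move: (k.*2%:R) => d.
ring.
Qed.

Lemma bump_supp k t : 1 <= `|t| -> bump k t = 0.
Proof.
move=> t1; rewrite /bump expinv0 ?mulr0// subr_le0.
by rewrite -[t ^+ 2]real_normK ?num_real// exprn_ege1.
Qed.

Lemma bump_ge0 t : 0 <= bump 0 t.
Proof.
rewrite /bump hornerC mul1r /expinv; case: ifP => // _.
by rewrite expr0 mul1r expR_ge0.
Qed.

Lemma bump_gt t : `|t| <= 1 / 2 -> expR (- 2) <= bump 0 t.
Proof.
move=> t1; rewrite /bump hornerC mul1r /expinv expr0 mul1r.
have : `|t| ^+ 2 <= (1/2) ^+ 2 by apply: lerXn2r => //; rewrite nnegrE; lra.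
rewrite real_normK ?num_real// => H.
rewrite ifT; last by lra.
rewrite ler_expR lerN2 -[2]invrK lef_pV2 ?posrE; lra.
Qed.

Lemma bump_bounded k : exists2 C, 0 <= C & forall t, `|bump k t| <= C.
Proof.
have c : continuous (fun t => `|bump k t|).
  move=> t; apply: continuous_comp; last exact: norm_continuous.
  apply: differentiable_continuous; apply/derivable1_diffP.
  exact: (@ex_derive _ _ _ _ _ _ _ (is_derive_bump k t)).
have [|x _ xm] := @EVT_max R (fun t => `|bump k t|) (-1) 1 _ (continuous_subspaceT c).
  by lra.
exists `|bump k x| => // t.
have [t1|t1] := leP 1 `|t|; first by rewrite bump_supp// normr0.
by apply: xm; rewrite in_itv /= -ler_norml ltW.
Qed.

End Bump.

(** * Taylor estimates and the mollifier *)

Section Taylor.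
Context {R : realType}.
Implicit Types (f F : R -> R) (K : R).

Lemma is_derive_continuous f f' : (forall t : R, is_derive t (1 : R) f (f' t)) ->
  continuous f.
Proof.
move=> df t; apply: differentiable_continuous; apply/derivable1_diffP.
exact: (@ex_derive _ _ _ _ _ _ _ (df t)).
Qed.

Lemma MVT_le f f' (a b K : R) : a <= b ->
  (forall t : R, is_derive t (1 : R) f (f' t)) ->
  (forall t, a <= t <= b -> `|f' t| <= K) ->
  `|f b - f a| <= K * (b - a).
Proof.
move=> ab df fK.
have [c cab ->] := MVT_segment ab (fun x _ => df x)
  (continuous_subspaceT (is_derive_continuous df)).
rewrite normrM [`|b - a|]ger0_norm ?subr_ge0// ler_wpM2r ?subr_ge0//.
exact: fK.
Qed.

Lemma is_derive_opp_arg f (d t : R) : is_derive (- t) (1 : R) f d ->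
  is_derive t (1 : R) (fun h => f (- h)) (- d).
Proof.
move=> df; rewrite -mulrN1.
exact: (@is_derive1_comp _ f (fun h : R => - h) t _ _ df (is_deriveNid t (1 : R))).
Qed.

Section Bounds.
Variables (F0 F1 F2 F3 : R -> R).
Hypothesis d0 : forall t : R, is_derive t (1 : R) F0 (F1 t).
Hypothesis d1 : forall t : R, is_derive t (1 : R) F1 (F2 t).
Hypothesis d2 : forall t : R, is_derive t (1 : R) F2 (F3 t).

Lemma taylor1_le K : (forall t, `|F1 t| <= K) -> `|F0 1 - F0 0| <= K.
Proof.
move=> FK; rewrite -[K]mulr1 -[X in K * X]subr0; exact: MVT_le.
Qed.

Lemma taylor2_le K : (forall t, `|F2 t| <= K) -> `|F0 1 - F0 0 - F1 0| <= K.
Proof.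
move=> FK.
have K0 : 0 <= K by apply: le_trans (FK 0).
have dG (t : R) : is_derive t (1 : R) (fun h => F0 h - h * F1 0) (F1 t - F1 0).
  have -> : (fun h => F0 h - h * F1 0) = F0 - (F1 0 *: id).
    by apply/funext => h; rewrite !fctE mulrC.
  have /is_derive_eq := is_deriveB (d0 t) (is_deriveZ (F1 0) (is_derive_id t (1:R))).
  by apply; rewrite /GRing.scale /= mulr1.
have := MVT_le ler01 dG.
move=> /(_ K); rewrite mul1r mul0r !subr0 mulr1 addrAC; apply => t /andP[t0 t1].
have := MVT_le t0 d1 (fun x _ => FK x).
by move=> /le_trans; apply; rewrite subr0 ler_piMr.
Qed.

Lemma second_diff_le K : (forall t, `|F2 t| <= K) ->
  `|F0 1 + F0 (-1) - 2 * F0 0| <= 2 * K.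
Proof.
move=> FK.
have K0 : 0 <= K by apply: le_trans (FK 0).
have dG (t : R) : is_derive t (1 : R) (fun h => F0 h + F0 (- h)) (F1 t - F1 (- t)).
  by have /is_derive_eq := is_deriveD (d0 t) (is_derive_opp_arg (d0 (- t))); apply.
have := MVT_le ler01 dG.
move=> /(_ (2 * K)); rewrite subr0 mulr1 oppr0.
rewrite (_ : 2 * F0 0 = F0 0 + F0 0); last by ring.
apply => t /andP[t0 t1].
have tt : - t <= t by lra.
have := MVT_le tt d1 (fun x _ => FK x).
move=> /le_trans; apply; rewrite opprK mulrC ler_wpM2r//; lra.
Qed.

(** The even part F0 h + F0 (-h) has zero slope at 0, and subtracting c h^2 with c = F2 0 also
    cancels its curvature there: the second derivative becomes two increments of F2, each at most K
    on [0, 1]. Two mean-value steps finish. *)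
Lemma second_diff_taylor K : (forall t, `|F3 t| <= K) ->
  `|F0 1 + F0 (-1) - 2 * F0 0 - F2 0| <= 2 * K.
Proof.
move=> FK.
have K0 : 0 <= K by apply: le_trans (FK 0).
pose c := F2 0.
have dG (t : R) : is_derive t (1 : R) (fun h => F0 h + F0 (- h) - c * h ^+ 2)
    (F1 t - F1 (- t) - 2 * c * t).
  have -> : (fun h => F0 h + F0 (- h) - c * h ^+ 2) =
    (F0 + (fun h => F0 (- h))) - (c *: (id ^+ 2)).
    by apply/funext => h; rewrite !fctE.
  have /is_derive_eq := is_deriveB (is_deriveD (d0 t) (is_derive_opp_arg (d0 (- t))))
    (is_deriveZ c (is_deriveX 2 (is_derive_id t (1:R)))).
  apply; rewrite /GRing.scale /= mulr1; ring.
have dH (t : R) : is_derive t (1 : R) (fun t => F1 t - F1 (- t) - 2 * c * t)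
    (F2 t + F2 (- t) - 2 * c).
  have -> : (fun t => F1 t - F1 (- t) - 2 * c * t) =
    (F1 - (fun h => F1 (- h))) - ((2 * c) *: id).
    by apply/funext => h; rewrite !fctE.
  have /is_derive_eq := is_deriveB (is_deriveB (d1 t) (is_derive_opp_arg (d1 (- t))))
    (is_deriveZ (2 * c) (is_derive_id t (1:R))).
  apply; rewrite /GRing.scale /= mulr1; ring.
have := MVT_le ler01 dG.
move=> /(_ (2 * K)); rewrite subr0 mulr1 oppr0 expr1n expr0n /= mulr0 subr0 mulr1.
rewrite (_ : 2 * F0 0 = F0 0 + F0 0); last by ring.
rewrite addrAC; apply => t /andP[t0 t1].
have := MVT_le t0 dH.
move=> /(_ (2 * K)); rewrite (subr0 t) oppr0 mulr0 !subrr subr0 => H.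
apply: le_trans (H _) _; last by rewrite ler_piMr// mulr_ge0.
move=> s /andP[s0 st].
have s1 : s <= 1 by exact: le_trans t1.
have Ks : K * s <= K by rewrite ler_piMr.
have A := MVT_le s0 d2 (fun x _ => FK x); rewrite subr0 in A.
have sN : - s <= 0 by lra.
have B := MVT_le sN d2 (fun x _ => FK x).
rewrite opprK add0r distrC in B.
rewrite (_ : _ - _ = (F2 s - c) + (F2 (- s) - c)); last by rewrite /c; ring.
apply: le_trans (ler_normD _ _) _.
by rewrite [leRHS]mulr_natl mulr2n lerD// (le_trans A, le_trans B).
Qed.

End Bounds.
End Taylor.

(** * Directional derivatives through restriction to lines *)

Section Line.
Context {R : realType} {V : normedModType R}.
Implicit Types (f : V -> R) (x v : V).

Lemma is_derive_line f x v (h d : R) :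
  is_derive (h *: v + x) v f d -> is_derive h (1 : R) (fun k => f (k *: v + x)) d.
Proof.
have E : (fun k : R => k^-1 *: ((f \o shift (h *: v + x)) (k *: v) - f (h *: v + x))) =
  (fun k : R => k^-1 *: (((fun k => f (k *: v + x)) \o shift h) (k *: (1 : R)) - f (h *: v + x))).
  by apply/funext => k /=; rewrite [k *: 1]mulr1 scalerDl addrA.
move=> [df dE]; apply: DeriveDef.
  by move: df; rewrite /derivable E.
by move: dE; rewrite /derive E.
Qed.

Lemma is_derive_of_line f x v (d : R) :
  is_derive (0 : R) (1 : R) (fun k => f (k *: v + x)) d -> is_derive x v f d.
Proof.
have E : (fun k : R => k^-1 *: ((f \o shift x) (k *: v) - f x)) =
  (fun k : R => k^-1 *: (((fun k => f (k *: v + x)) \o shift 0) (k *: (1 : R)) - f (0 *: v + x))).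
  by apply/funext => k /=; rewrite [k *: 1]mulr1 addr0 scale0r add0r.
move=> [df dE]; apply: DeriveDef.
  by move: df; rewrite /derivable -E.
by move: dE; rewrite /derive -E.
Qed.

Lemma is_derive_prod (I : eqType) (r : seq I) (f : I -> V -> R) (f' : I -> R) x v :
  uniq r -> (forall i, is_derive x v (f i) (f' i)) ->
  is_derive x v (fun y => \prod_(i <- r) f i y)
    (\sum_(i <- r) \prod_(j <- r) (if j == i then f' j else f j x)).
Proof.
move=> + df; elim: r => [_|a r IH /= /andP[ar ur]].
  rewrite big_nil.
  have -> : (fun y => \prod_(i <- [::]) f i y) = cst 1.
    by apply/funext => y; rewrite big_nil.
  exact: is_derive_cst.
have -> : (fun y => \prod_(i <- a :: r) f i y) =
    f a * (fun y => \prod_(i <- r) f i y).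
  by apply/funext => y; rewrite big_cons.
have /is_derive_eq := is_deriveM (df a) (IH ur); apply.
rewrite big_cons big_cons eqxx addrC /GRing.scale /=; congr (_ + _).
  rewrite mulrC; congr (_ * _); apply: eq_big_seq => i ir.
  by case: eqP => // ia; move: ar; rewrite -ia ir.
rewrite big_distrr /=; apply: eq_big_seq => i ir; rewrite big_cons.
by case: eqP => // ia; move: ar; rewrite ia ir.
Qed.

End Line.

(** * The product bump and its derivatives *)

Section Mollifier.
Context {R : realType} {N : nat}.
Variable lam : R.
Implicit Types (x y z : 'rV[R]_N) (s : seq 'I_N).

(* The partial derivative, along the multi-index [s], of the bump of
   half-width [lam^-1] centered at [x]. *)
Definition molli x s y : R :=
  \prod_(i < N) (lam ^+ (count_mem i s) *
    bump (count_mem i s) (lam * (y ord0 i - x ord0 i))).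

(** Product rule over factors of one coordinate each: differentiating the i-th factor raises the
    count of i in the multi-index, whence [i :: s]. *)
Lemma is_derive_molli x s y z :
  is_derive y z (molli x s) (\sum_i z ord0 i * molli x (i :: s) y).
Proof.
have df (i : 'I_N) : is_derive y z
    (fun y => lam ^+ (count_mem i s) * bump (count_mem i s) (lam * (y ord0 i - x ord0 i)))
    (lam ^+ (count_mem i s) *
       (bump (count_mem i s).+1 (lam * (y ord0 i - x ord0 i)) * (lam * z ord0 i))).
  apply: is_derive_of_line.
  pose g (k : R) := lam * ((k *: z + y) ord0 i - x ord0 i).
  have dg : is_derive (0:R) (1:R) g (lam * z ord0 i).
    have -> : g = cst (lam * (y ord0 i - x ord0 i)) + ((lam * z ord0 i) *: id).
      apply/funext => k; rewrite /g !fctE !mxE /GRing.scale /=; ring.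
    have /is_derive_eq := is_deriveD (is_derive_cst (lam * (y ord0 i - x ord0 i)) (0:R) (1:R))
       (is_deriveZ (lam * z ord0 i) (is_derive_id (0:R) (1:R))).
    by apply; rewrite add0r /GRing.scale /= mulr1.
  have g0 : g 0 = lam * (y ord0 i - x ord0 i) by rewrite /g scale0r add0r.
  have H := @is_derive1_comp _ (bump (count_mem i s)) g 0 _ _ (is_derive_bump _ (g 0)) dg.
  rewrite g0 in H.
  exact: (is_deriveZ (lam ^+ (count_mem i s)) H).
have /is_derive_eq := is_derive_prod (index_enum_uniq 'I_N) df; apply.
apply: eq_bigr => i _.
rewrite /molli (bigD1 i)//= [in RHS](bigD1 i)//= !eqxx add1n exprS.
rewrite (eq_bigr (fun j : 'I_N => lam ^+ ((i == j) + count_mem j s) *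
    bump ((i == j) + count_mem j s) (lam * (y ord0 j - x ord0 j)))); first by ring.
by move=> j ji; rewrite eq_sym in ji; rewrite (negbTE ji) eq_sym (negbTE ji).
Qed.

Lemma molli_continuous x s : continuous (molli x s).
Proof.
have cM (f g : 'rV[R]_N -> R) : continuous f -> continuous g ->
  continuous (fun y => f y * g y).
  move=> cf cg y.
   exact: (@cvgM _ _ (nbhs (y : 'rV[R]_N)) _ f g _ _ (cf y) (cg y)).
rewrite /molli; elim: (index_enum 'I_N) => [|i r IH].
  by under eq_fun do rewrite big_nil; exact: cst_continuous.
under eq_fun do rewrite big_cons.
apply: (cM (fun y => _ * _) _ _ IH); apply: (cM _ _ _); first exact: cst_continuous.
move=> y; apply: (@continuous_comp _ _ _ (fun y : 'rV[R]_N => lam * (y ord0 i - x ord0 i)) (bump _)).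
  apply: (cM (fun=> lam) (fun y : 'rV[R]_N => y ord0 i - x ord0 i)).
    exact: cst_continuous.
  move=> w; apply: (@continuousB _ _ _ (fun y : 'rV[R]_N => y ord0 i) (fun=> x ord0 i)).
    exact: coord_continuous.
  exact: cst_continuous.
exact: (is_derive_continuous (is_derive_bump _)).
Qed.

Lemma iter_partial_molli x s : iter_partial s (molli x [::]) = molli x s.
Proof.
elim: s => //= i s ->; apply/funext => y; rewrite /partial.
have [_ ->] := is_derive_molli x s y (ebasis R i).
rewrite (bigD1 i)//= big1 ?addr0; first by rewrite mxE !eqxx mul1r.
by move=> j ji; rewrite mxE eqxx (negbTE ji) mul0r.
Qed.

Hypothesis lam0 : 0 < lam.

Lemma molli_supp x s y i : lam^-1 <= `|y ord0 i - x ord0 i| -> molli x s y = 0.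
Proof.
move=> H; apply/eqP; rewrite prodf_seq_eq0; apply/hasP; exists i => //=.
  exact: mem_index_enum.
rewrite bump_supp ?mulr0//.
by rewrite normrM gtr0_norm// -ler_pdivrMl// mulr1.
Qed.

Lemma molli_Cc_inf x : Cc_inf (molli x [::]).
Proof.
split.
  move=> s; rewrite iter_partial_molli; split; first exact: molli_continuous.
  move=> i y; exact: (@ex_derive _ _ _ _ _ _ _ (is_derive_molli x s y _)).
pose B := [set y : 'rV[R]_N | forall i,
   `[x ord0 i - lam^-1, x ord0 i + lam^-1]%classic (y ord0 i)].
have cB : compact B.
  exact: (@rV_compact R N (fun i => `[x ord0 i - lam^-1, x ord0 i + lam^-1]%classic)
           (fun i => @segment_compact _ _ _)).
apply: (subclosed_compact _ cB); first exact: closed_closure.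
have Bc : closed B by apply: compact_closed cB; exact: norm_hausdorff.
rewrite (closure_id B).1//; apply: closure_subset => y /= y0 i.
rewrite /B /= in_itv /= -ler_distlC distrC leNgt; apply: contra y0 => /ltW H.
by rewrite (molli_supp _ H).
Qed.

(** Turns a second difference of the test function in y into a combination of bumps centred at x -
    z, x + z and x, hence into a second difference of [mollify] in x. *)
Lemma molli_shift x s y z : molli x s (z + y) = molli (x - z) s y.
Proof.
apply: eq_bigr => i _; congr (_ * bump _ (_ * _)); rewrite !mxE; ring.
Qed.

(** The constant is uniform in the centre x, since the jump term uses the bump at the moving centres
    x - z and x + z. *)
Lemma molli_bounded s : exists2 K, 0 <= K & forall x y, `|molli x s y| <= K.
Proof.
rewrite /molli; elim: (index_enum 'I_N) => [|i r [K K0 IH]].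
  by exists 1 => // x y; rewrite big_nil normr1.
have [C C0 HC] := @bump_bounded R (count_mem i s).
exists (lam ^+ count_mem i s * C * K); first by rewrite !mulr_ge0 ?exprn_ge0 ?(ltW lam0).
move=> x y; rewrite big_cons normrM ler_pM ?mulr_ge0 //.
by rewrite normrM ger0_norm ?exprn_ge0 ?(ltW lam0)// ler_wpM2l ?exprn_ge0 ?(ltW lam0).
Qed.

Lemma molli_ge0 x y : 0 <= molli x [::] y.
Proof. by apply: prodr_ge0 => i _; rewrite expr0 mul1r bump_ge0. Qed.

Lemma molli_gt x y : (forall i, `|y ord0 i - x ord0 i| <= (2 * lam)^-1) ->
  expR (- 2) ^+ N <= molli x [::] y.
Proof.
move=> H; rewrite -[X in _ ^+ X]card_ord -prodr_const.
apply: ler_prod => i _; rewrite expR_ge0 /= expr0 mul1r; apply: bump_gt.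
rewrite normrM gtr0_norm// -ler_pdivlMl//.
by apply: le_trans (H i) _; rewrite invfM mulrC mul1r.
Qed.

(** The n-th derivative of [molli x s] along z, expanded over coordinates so that homogeneity in z,
    support and bounds all follow by induction on n from those of [molli]. *)
Fixpoint dmolli x z n s y : R :=
  if n is n'.+1 then \sum_i z ord0 i * dmolli x z n' (i :: s) y
  else molli x s y.

Lemma is_derive_dmolli x z n s y :
  is_derive y z (dmolli x z n s) (dmolli x z n.+1 s y).
Proof.
elim: n s => [|n IH] s; first exact: is_derive_molli.
have -> : dmolli x z n.+1 s = \sum_(i < N) (z ord0 i *: dmolli x z n (i :: s)).
  by apply/funext => y'; rewrite fct_sumE; apply: eq_bigr => i _; rewrite !fctE.
exact: (is_derive_sum (fun i => is_deriveZ (z ord0 i) (IH (i :: s)))).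
Qed.

Lemma dmolliZ x z n s y (h : R) :
  dmolli x (h *: z) n s y = h ^+ n * dmolli x z n s y.
Proof.
elim: n s => [|n IH] s; first by rewrite mul1r.
rewrite /= big_distrr /=; apply: eq_bigr => i _.
by rewrite IH mxE exprS; ring.
Qed.

Lemma dmolli_supp x z n s y i : lam^-1 <= `|y ord0 i - x ord0 i| ->
  dmolli x z n s y = 0.
Proof.
move=> H; elim: n s => [|n IH] s; first exact: molli_supp H.
by rewrite /= big1// => j _; rewrite IH mulr0.
Qed.

Lemma normr_le_enorm z i : `|z ord0 i| <= enorm z.
Proof.
rewrite -sqrtr_sqr /enorm; apply: ler_wsqrtr.
by rewrite (bigD1 i)//= lerDl; apply: sumr_ge0 => j _; exact: sqr_ge0.
Qed.

Lemma dmolli_bounded n s : exists2 K, 0 <= K &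
  forall x z y, `|dmolli x z n s y| <= K * enorm z ^+ n.
Proof.
elim: n s => [|n IH] s.
  have [K K0 HK] := molli_bounded s; exists K => // x z y.
  by rewrite expr0 mulr1; exact: HK.
pose K i := sval (cid2 (IH (i :: s))).
have KP i := svalP (cid2 (IH (i :: s))).
exists (\sum_i K i); first by apply: sumr_ge0 => i _; case: (KP i).
move=> x z y /=; apply: le_trans (ler_norm_sum _ _ _) _.
rewrite mulr_suml; apply: ler_sum => i _.
rewrite normrM exprS mulrCA ler_pM// ?normr_le_enorm//.
by case: (KP i) => _; apply.
Qed.

Lemma is_derive_dmolli_line x z n s y t :
  is_derive t (1 : R) (fun h : R => dmolli x z n s (h *: z + y))
    (dmolli x z n.+1 s (t *: z + y)).
Proof. by apply: is_derive_line; exact: is_derive_dmolli. Qed.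

Lemma molli_diff_le : exists2 K, 0 <= K & forall x z y,
  `|molli x [::] (y + z) - molli x [::] y| <= K * enorm z.
Proof.
have [K K0 HK] := dmolli_bounded 1 [::]; exists K => // x z y.
have := taylor1_le (is_derive_dmolli_line x z 0 [::] y).
move=> /(_ (K * enorm z)); rewrite /= scale0r add0r scale1r (addrC z); apply => t.
exact: HK.
Qed.

Lemma molli_taylor2 : exists2 K, 0 <= K & forall x z y,
  `|molli x [::] (y + z) - molli x [::] y - dmolli x z 1 [::] y| <= K * enorm z ^+ 2.
Proof.
have [K K0 HK] := dmolli_bounded 2 [::]; exists K => // x z y.
have := taylor2_le (is_derive_dmolli_line x z 0 [::] y) (is_derive_dmolli_line x z 1 [::] y).
move=> /(_ (K * enorm z ^+ 2)); rewrite /= !scale0r !add0r scale1r (addrC z); apply => t.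
exact: HK.
Qed.

Definition second_diff (f : 'rV[R]_N -> R) z x := f (x + z) + f (x - z) - 2 * f x.

Lemma molli_second_diff_le : exists2 K, 0 <= K & forall x z y,
  `|second_diff (molli x [::]) z y| <= K * enorm z ^+ 2.
Proof.
have [K K0 HK] := dmolli_bounded 2 [::]; exists (2 * K); first exact: mulr_ge0.
move=> x z y.
have := second_diff_le (is_derive_dmolli_line x z 0 [::] y) (is_derive_dmolli_line x z 1 [::] y).
move=> /(_ (K * enorm z ^+ 2)); rewrite !scale0r !add0r scaleN1r scale1r !(addrC _ y) -mulrA.
by apply => t; exact: HK.
Qed.

Lemma molli_second_diff_taylor : exists2 K, 0 <= K & forall x z y,
  `|second_diff (molli x [::]) z y - dmolli x z 2 [::] y| <= K * enorm z ^+ 3.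
Proof.
have [K K0 HK] := dmolli_bounded 3 [::]; exists (2 * K); first exact: mulr_ge0.
move=> x z y.
have := second_diff_taylor (is_derive_dmolli_line x z 0 [::] y)
  (is_derive_dmolli_line x z 1 [::] y) (is_derive_dmolli_line x z 2 [::] y).
move=> /(_ (K * enorm z ^+ 3)); rewrite !scale0r !add0r scaleN1r scale1r !(addrC _ y) -mulrA.
by apply => t; exact: HK.
Qed.

Lemma derive_molli x z y : derive (molli x [::]) y z = dmolli x z 1 [::] y.
Proof. by have [_ ->] := is_derive_dmolli x z 0 [::] y. Qed.

Lemma derive2_molli x z y :
  derive (fun y => derive (molli x [::]) y z) y z = dmolli x z 2 [::] y.
Proof.
under eq_fun do rewrite derive_molli.
by have [_ ->] := is_derive_dmolli x z 1 [::] y.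
Qed.

End Mollifier.

(** * Borel measurability and iterated integrals *)

Section BorelRV.
Context {R : realType} {N : nat}.

(** An open set is the countable union of the boxes with rational centre and half-width 1/(k+1) that
    it contains, and the preimage of a box is a finite intersection of conditions on coordinates. *)
Lemma measurable_fun_rV d (T : measurableType d) (f : T -> borelRV R N) :
  (forall i, measurable_fun setT (fun t => (f t : 'rV[R]_N) ord0 i)) ->
  measurable_fun setT f.
Proof.
move=> mf; apply: (@measurability _ _ T (borelRV R N) setT f (@open 'rV[R]_N)) => //.
move=> _ [U oU <-]; rewrite setTI.
pose r (k : nat) : R := k.+1%:R^-1.
pose box (p : 'rV[rat]_N * nat) (y : 'rV[R]_N) :=
  forall i, `|y ord0 i - ratr (p.1 ord0 i)| < r p.2.
pose F (p : 'rV[rat]_N * nat) : set T := [set t | (box p `<=` U) /\ box p (f t)].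
have -> : f @^-1` U = \bigcup_p F p.
  rewrite predeqE => t; split => [Ut|[p _ [pU pt]]]; last exact: pU.
  have /nbhs_ballP[e /= e0 eU] : nbhs (f t : 'rV[R]_N) U by exact: open_nbhs_nbhs.
  (* With half-width below e / 2, a box that contains [f t] stays in the ball of radius e around
     it. *)
  have [k ke] : exists k, r k < e / 2.
    have e2 : 0 < e / 2 by rewrite divr_gt0.
    have [k ke] := ltr_add_invr (y := 0) (x := e / 2) e2.
    by exists k; rewrite add0r in ke.
  have r0 : 0 < r k by rewrite invr_gt0 ltr0n.
  have Q i : exists q : rat, `|(f t : 'rV[R]_N) ord0 i - ratr q| < r k.
    have /rat_in_itvoo[q] : (f t : 'rV[R]_N) ord0 i - r k < (f t : 'rV[R]_N) ord0 i + r k by lra.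
    rewrite in_itv /= => /andP[q1 q2]; exists q.
    by rewrite ltr_distlC; apply/andP; split; lra.
  have [q Hq] := choice Q.
  exists (\row_i q i, k) => //; split => [y By|i] /=; last by rewrite mxE.
  apply: eU; split=> // i j; rewrite /ball /= ord1.
  have := By j; have := Hq j; rewrite /= mxE => A B.
  rewrite (_ : _ - _ = ((f t : 'rV[R]_N) ord0 j - ratr (q j)) - (y ord0 j - ratr (q j))); last by ring.
  apply: le_lt_trans (ler_normB _ _) _; lra.
apply: countable_bigcupT_measurable => // p.
have [pU|pU] := pselect (box p `<=` U); last first.
  by rewrite (_ : F p = set0)// predeqE => t; split=> // -[].
have -> : F p = \bigcap_(i in [set: 'I_N]) [set t | `|(f t : 'rV[R]_N) ord0 i - ratr (p.1 ord0 i)| < r p.2].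
  rewrite predeqE => t; split => [[_ H] i _|H]; [exact: H|split => // i; exact: H].
apply: fin_bigcap_measurable => // i _.
have := @measurable_fun_ltr _ T R setT
  (fun t => `|(f t : 'rV[R]_N) ord0 i - ratr (p.1 ord0 i)|) (cst (r p.2)).
move=> /(_ _ _ measurableT [set true]); rewrite setTI; apply => //.
apply: measurableT_comp => //; apply: measurable_funB => //.
Qed.

Lemma continuous_measurable_rV (f : 'rV[R]_N -> R) : continuous f ->
  measurable_fun setT (f : borelRV R N -> R).
Proof.
move=> /continuousP cf.
apply: (@measurability _ _ (borelRV R N) R setT f _ (RGenOInfty.measurableE R)).
move=> _ [_ [x ->] <-]; rewrite setTI; apply: sub_sigma_algebra.
by apply: cf; rewrite set_itvE; exact: open_gt.
Qed.

Lemma measurable_coord i : measurable_fun setT (fun y : borelRV R N => (y : 'rV[R]_N) ord0 i).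
Proof. by apply: continuous_measurable_rV => y; exact: coord_continuous. Qed.

Lemma measurable_upd d (T : measurableType d) (f : T -> borelRV R N) (g : T -> R) m :
  measurable_fun setT f -> measurable_fun setT g ->
  measurable_fun setT (fun t => upd (f t : 'rV[R]_N) m (g t) : borelRV R N).
Proof.
move=> mf mg; apply: measurable_fun_rV => i.
under eq_fun do rewrite mxE; case: eqP => // _.
exact: (measurableT_comp (measurable_coord i)).
Qed.

Lemma measurable_addr d (T : measurableType d) (f g : T -> borelRV R N) :
  measurable_fun setT f -> measurable_fun setT g ->
  measurable_fun setT (fun t => (f t : 'rV[R]_N) + (g t : 'rV[R]_N) : borelRV R N).
Proof.
move=> mf mg; apply: measurable_fun_rV => i.
under eq_fun do rewrite mxE.
by apply: measurable_funD; apply: (measurableT_comp (measurable_coord i)).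
Qed.

Lemma measurable_oppr d (T : measurableType d) (f : T -> borelRV R N) :
  measurable_fun setT f ->
  measurable_fun setT (fun t => - (f t : 'rV[R]_N) : borelRV R N).
Proof.
move=> mf; apply: measurable_fun_rV => i.
under eq_fun do rewrite mxE.
by apply: measurable_funN; apply: (measurableT_comp (measurable_coord i)).
Qed.

Lemma measurable_enorm : measurable_fun setT (@enorm R N : borelRV R N -> R).
Proof.
apply: (@measurableT_comp _ _ _ _ _ _ (@Num.sqrt R)).
  by apply: continuous_measurable_fun; exact: sqrt_continuous.
apply: measurable_sum => i; apply: measurable_funX; exact: measurable_coord.
Qed.

End BorelRV.

Section ParamIntegral.
Context {R : realType} d1 d2 (T1 : measurableType d1) (T2 : measurableType d2).
Variable m : {sigma_finite_measure set T2 -> \bar R}.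

(** Tonelli applies to the positive and negative parts. Where the integral is not finite, [fine]
    gives its default value, and the result is still measurable. *)
Lemma measurable_fun_param_Rintegral (f : T1 * T2 -> R) : measurable_fun setT f ->
  measurable_fun setT (fun x => \int[m]_y f (x, y)).
Proof.
move=> /measurable_EFinP mf.
apply: (measurableT_comp (fine_measurable measurableT)).
have -> : (fun x => \int[m]_y (f (x, y))%:E)%E =
    ((fun x => \int[m]_y (EFin \o f)^\+ (x, y)) \-
     (fun x => \int[m]_y (EFin \o f)^\- (x, y)))%E.
  apply/funext => x; rewrite [LHS]integralE.
  by congr (_ - _)%E; apply: eq_integral => y _; rewrite ?funeposE ?funenegE.
apply: emeasurable_funB.
  have := @measurable_fun_fubini_tonelli_F _ _ T1 T2 R m (EFin \o f)^\+%E.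
  by move=> /(_ (measurable_funepos mf)) H; apply: H.
have := @measurable_fun_fubini_tonelli_F _ _ T1 T2 R m (EFin \o f)^\-%E.
by move=> /(_ (measurable_funeneg mf)) H; apply: H.
Qed.

End ParamIntegral.

(** * Iterated integrals of functions dominated by cubes *)

Section Iint.
Context {R : realType} {N : nat}.
Local Notation leb := (@lebesgue_measure R).
Local Notation V := 'rV[R]_N.
Local Notation B := (borelRV R N).

(** Joint measurability in the parameter and the base point is what the induction has to carry:
    [upd] makes the base point depend on the next variable of integration. *)
Lemma measurable_iint d (T : measurableType d) (g : T -> V -> R) m :
  measurable_fun setT (fun p : T * B => g p.1 p.2) ->
  measurable_fun setT (fun p : T * B => iint m (g p.1) p.2).
Proof.
move=> mg; elim: m => //= m IH.
apply: (@measurable_fun_param_Rintegral _ _ _ _ _ leb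
  (fun q : (T * B) * R => iint m (g q.1.1) (upd q.1.2 m q.2))).
apply: (measurableT_comp IH (g := fun q : (T * B) * R => (q.1.1, upd q.1.2 m q.2 : B))).
apply: measurable_fun_pair; first exact: measurableT_comp.
by apply: measurable_upd => //; exact: measurableT_comp.
Qed.

Lemma measurable_iint1 (g : V -> R) m : measurable_fun setT (g : B -> R) ->
  measurable_fun setT (iint m g : B -> R).
Proof.
move=> mg.
have := @measurable_iint _ B (fun _ => g) m.
move=> /(_ (measurableT_comp mg measurable_snd)) H.
apply: (measurableT_comp H (g := fun y : B => ((y, y) : B * B))).
exact: measurable_fun_pair.
Qed.

Variable A : R.
Hypothesis A0 : 0 < A.

(* Indicator of the cube of half-width [A] and center [c] in the coordinates that
   [iint m] leaves free. *)
Definition cube (m : nat) (c y : V) : R :=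
  \prod_(i < N | (m <= i)%N) \1_(`[c ord0 i - A, c ord0 i + A]) (y ord0 i).

(** Several centres, because the second difference of a bump lives near x, x - z and x + z: the
    region moves with z, but its volume is controlled by the number of centres. *)
Definition cubes m (cs : seq V) y : R := \sum_(c <- cs) cube m c y.

Lemma indic01 (S : set R) t : 0 <= (\1_S t : R) <= 1.
Proof. by rewrite indicE ler0n /=; case: (_ \in _); rewrite ?lexx// ler01. Qed.

Lemma cube_ge0 m c y : 0 <= cube m c y.
Proof. by apply: prodr_ge0 => i _; case/andP: (indic01 `[c ord0 i - A, c ord0 i + A] (y ord0 i)). Qed.

Lemma cube_le1 m c y : cube m c y <= 1.
Proof. by apply: prodr_ile1 => i _; exact: indic01. Qed.

Lemma cubes_ge0 m cs y : 0 <= cubes m cs y.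
Proof. by apply: sumr_ge0 => c _; exact: cube_ge0. Qed.

Lemma cubes_le m cs y : cubes m cs y <= (size cs)%:R.
Proof.
elim: cs => [|c cs IH]; rewrite /cubes ?big_nil// big_cons /= -natr1 addrC.
by rewrite lerD// cube_le1.
Qed.

Lemma cube_upd (i : 'I_N) c y t :
  cube i c (upd y i t) = cube i.+1 c y * \1_(`[c ord0 i - A, c ord0 i + A]) t.
Proof.
rewrite /cube (bigD1 i)//= mxE eqxx mulrC; congr (_ * _).
apply: eq_big => j; first by rewrite ltn_neqAle eq_sym andbC.
by move=> /andP[_ ji]; rewrite mxE ifN.
Qed.

Lemma integral_slab (a : R) : leb.-integrable setT (EFin \o \1_(`[a - A, a + A])) /\
  \int[leb]_t \1_(`[a - A, a + A]) t = 2 * A.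
Proof.
have E : (\int[leb]_t (\1_(`[a - A, a + A]) t)%:E = (2 * A)%:E)%E.
  rewrite integral_indic// setIT; apply: etrans (lebesgue_measure_itv _) _.
  have AA : a - A < a + A by move: A0 => ?; lra.
  rewrite /= lte_fin AA.
  by rewrite -EFinB; congr EFin; ring.
split; last by rewrite /Rintegral E.
apply/integrableP; split; first exact/measurable_EFinP/measurable_indic.
under eq_integral => t _.
  rewrite /= ger0_norm; last by case/andP: (indic01 `[a - A, a + A] t).
  over.
by rewrite E ltry.
Qed.

Lemma integral_cubes (i : 'I_N) cs y :
  leb.-integrable setT (EFin \o (fun t => cubes i cs (upd y i t))) /\
  \int[leb]_t cubes i cs (upd y i t) = 2 * A * cubes i.+1 cs y.
Proof.
elim: cs => [|c cs [I1 I2]].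
  have -> : (fun t => cubes i [::] (upd y i t)) = cst 0.
    by apply/funext => t; rewrite /cubes big_nil.
  rewrite /cubes big_nil mulr0; split; last by rewrite Rintegral_cst// mul0r.
  exact: integrable0.
have [J1 J2] := integral_slab (c ord0 i).
have -> : (fun t => cubes i (c :: cs) (upd y i t)) =
  (fun t => cube i.+1 c y * \1_(`[c ord0 i - A, c ord0 i + A]) t + cubes i cs (upd y i t)).
  by apply/funext => t; rewrite /cubes big_cons cube_upd.
have K1 : leb.-integrable setT
   (EFin \o (fun t => cube i.+1 c y * \1_(`[c ord0 i - A, c ord0 i + A]) t)).
  exact: (integrableZl _ (cube i.+1 c y) J1).
split; first exact: (integrableD _ K1 I1).
rewrite RintegralD// RintegralZl// J2 I2 /cubes big_cons; ring.
Qed.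

(** One step of the iterated integral: integrating out coordinate i costs the slab width 2 * A and
    keeps the domination in the remaining coordinates. *)
Lemma Rintegral_upd_cubes (i : 'I_N) cs (f : V -> R) C y : 0 <= C ->
  measurable_fun setT (f : B -> R) ->
  (forall y, `|f y| <= C * cubes i cs y) ->
  leb.-integrable setT (EFin \o (fun t => f (upd y i t))) /\
  \int[leb]_t `|f (upd y i t)| <= C * (2 * A) * cubes i.+1 cs y.
Proof.
move=> C0 mf fC.
have [I1 I2] := integral_cubes i cs y.
have J1 : leb.-integrable setT (EFin \o (fun t => C * cubes i cs (upd y i t))).
  exact: (integrableZl _ C I1).
have mfu : measurable_fun setT (fun t => f (upd y i t)).
  apply: (measurableT_comp mf (g := fun t => upd y i t : B)).
  exact: measurable_upd.
have If : leb.-integrable setT (EFin \o (fun t => f (upd y i t))).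
  apply: (le_integrable measurableT _ _ J1); first exact/measurable_EFinP.
  move=> t _ /=; rewrite lee_fin [leRHS]ger0_norm ?mulr_ge0 ?cubes_ge0//.
split => //.
rewrite -mulrA -I2 -RintegralZl//.
apply: le_Rintegral => //.
by have := integrable_abse If; rewrite /comp /=.
Qed.

(** Bounded Borel functions supported in finitely many cubes: a class stable under linear
    combinations on which each one-dimensional integral of [iint] converges absolutely, so that
    [Rintegral] is linear and monotone at every level. *)
Definition dominated (g : V -> R) := measurable_fun setT (g : B -> R) /\
  exists C cs, 0 <= C /\ forall y, `|g y| <= C * cubes 0 cs y.

Lemma iint_cubes (g : V -> R) C cs m : (m <= N)%N -> 0 <= C ->
  measurable_fun setT (g : B -> R) ->
  (forall y, `|g y| <= C * cubes 0 cs y) ->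
  forall y, `|iint m g y| <= C * (2 * A) ^+ m * cubes m cs y.
Proof.
move=> mN C0 mg gC; elim: m mN => [|m IH] mN y; first by rewrite mulr1; exact: gC.
have C1 : 0 <= C * (2 * A) ^+ m by rewrite mulr_ge0// exprn_ge0// mulr_ge0// ltW.
have [I1 I2] := Rintegral_upd_cubes (i := Ordinal mN) y C1 (measurable_iint1 m mg) (IH (ltnW mN)).
rewrite /= exprSr (mulrA C); apply: le_trans I2.
exact: le_normr_Rintegral.
Qed.

Lemma dominated_integrable (g : V -> R) m y : dominated g -> (m < N)%N ->
  leb.-integrable setT (EFin \o (fun t => iint m g (upd y m t))).
Proof.
move=> [mg [C [cs [C0 gC]]]] mN.
have C1 : 0 <= C * (2 * A) ^+ m by rewrite mulr_ge0// exprn_ge0// mulr_ge0// ltW.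
by have [] := Rintegral_upd_cubes (i := Ordinal mN) y C1 (measurable_iint1 m mg)
  (iint_cubes (ltnW mN) C0 mg gC).
Qed.

Lemma dominatedD f g : dominated f -> dominated g -> dominated (fun y => f y + g y).
Proof.
move=> [mf [C [cs [C0 fC]]]] [mg [D [ds [D0 gD]]]]; split; first exact: measurable_funD.
exists (C + D), (cs ++ ds); split; first exact: addr_ge0.
move=> y; rewrite /cubes big_cat /= -!/(cubes _ _ _).
apply: le_trans (ler_normD _ _) _.
have := fC y; have := gD y.
have := cubes_ge0 0 cs y; have := cubes_ge0 0 ds y; nra.
Qed.

Lemma dominatedZ a f : dominated f -> dominated (fun y => a * f y).
Proof.
move=> [mf [C [cs [C0 fC]]]]; split; first exact: measurable_funM.
exists (`|a| * C), cs; split; first exact: mulr_ge0.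
by move=> y; rewrite normrM -mulrA ler_wpM2l.
Qed.

Lemma dominated_sum n (f : 'I_n -> V -> R) : (forall i, dominated (f i)) ->
  dominated (fun y => \sum_i f i y).
Proof.
move=> df; elim: (index_enum _) => [|i r IH].
  under eq_fun do rewrite big_nil; split; first exact: measurable_cst.
  by exists 0, [::]; split=> // y; rewrite normr0 mul0r.
under eq_fun do rewrite big_cons; exact: dominatedD.
Qed.

Lemma iintD f g m y : (m <= N)%N -> dominated f -> dominated g ->
  iint m (fun y => f y + g y) y = iint m f y + iint m g y.
Proof.
move=> + df dg; elim: m y => //= m IH y mN.
rewrite -RintegralD//; [|exact: dominated_integrable..].
by apply: eq_Rintegral => t _; rewrite IH// ltnW.
Qed.

Lemma iintZ a f m y : (m <= N)%N -> dominated f ->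
  iint m (fun y => a * f y) y = a * iint m f y.
Proof.
move=> + df; elim: m y => //= m IH y mN.
rewrite -RintegralZl//; last exact: dominated_integrable.
by apply: eq_Rintegral => t _; rewrite IH// ltnW.
Qed.

Lemma iint_sum n (f : 'I_n -> V -> R) m y : (m <= N)%N ->
  (forall i, dominated (f i)) ->
  iint m (fun y => \sum_i f i y) y = \sum_i iint m (f i) y.
Proof.
move=> + df; elim: m y => //= m IH y mN.
under eq_Rintegral => t _ do rewrite IH ?(ltnW mN)//.
elim: (index_enum _) => [|i r IHr].
  under eq_Rintegral => t _ do rewrite big_nil.
  by rewrite big_nil Rintegral_cst// mul0r.
under eq_Rintegral => t _ do rewrite big_cons.
rewrite big_cons RintegralD ?IHr//; first exact: dominated_integrable.
have -> : (fun t => \sum_(j <- r) iint m (f j) (upd y m t)) =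
   \sum_(j <- r) (fun t => iint m (f j) (upd y m t)).
  by apply/funext => t; rewrite fct_sumE.
elim: {IHr} r => [|j r IHr]; first by rewrite big_nil; exact: integrable0.
rewrite big_cons; have := integrableD measurableT (dominated_integrable y (df j) mN) IHr.
exact.
Qed.

Lemma le_iint f g m y : (m <= N)%N -> dominated f -> dominated g ->
  (forall y, f y <= g y) -> iint m f y <= iint m g y.
Proof.
move=> + df dg fg; elim: m y => //= m IH y mN.
apply: le_Rintegral => //; [exact: dominated_integrable..|].
by move=> t _; apply: IH; exact: ltnW.
Qed.

Lemma iint_cube c m y : (m <= N)%N -> iint m (cube 0 c) y = (2 * A) ^+ m * cube m c y.
Proof.
elim: m y => [|m IH] y mN; first by rewrite mul1r.
rewrite /=.
under eq_Rintegral => t _ do rewrite IH ?(ltnW mN)// (cube_upd (Ordinal mN)).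
have [J1 J2] := integral_slab (c ord0 (Ordinal mN)).
under eq_Rintegral => t _ do rewrite mulrA.
by rewrite RintegralZl// J2 exprSr; ring.
Qed.

End Iint.

(** * Fubini's theorem for iterated integrals *)

Section RintegralFubini.
Context {R : realType} d1 d2 (T1 : measurableType d1) (T2 : measurableType d2).
Variable m1 : {sigma_finite_measure set T1 -> \bar R}.
Variable m2 : {sigma_finite_measure set T2 -> \bar R}.
Variable f : T1 * T2 -> R.
Hypothesis intf : (m1 \x m2)%E.-integrable setT (EFin \o f).
Hypothesis intf1 : forall x, m2.-integrable setT (EFin \o (fun y => f (x, y))).
Hypothesis intf2 : forall y, m1.-integrable setT (EFin \o (fun x => f (x, y))).

Lemma integrable_Rintegral1 :
  m1.-integrable setT (EFin \o (fun x => \int[m2]_y f (x, y))).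
Proof.
have := integrable_fubini_F intf; rewrite /fubini_F.
congr (_.-integrable _ _); apply/funext => x /=.
by rewrite /Rintegral (fineK (integrable_fin_num measurableT (intf1 x))).
Qed.

(** Integrability of every slice, and not just of almost every one, makes [fine] lossless pointwise,
    so the extended-real Fubini theorem transfers as it stands. *)
Lemma Rintegral_Fubini :
  \int[m1]_x \int[m2]_y f (x, y) = \int[m2]_y \int[m1]_x f (x, y).
Proof.
rewrite /Rintegral; congr fine.
under eq_integral => x _ do rewrite (fineK (integrable_fin_num measurableT (intf1 x))).
under [RHS]eq_integral => y _ do rewrite (fineK (integrable_fin_num measurableT (intf2 y))).
exact: (Fubini intf).
Qed.

End RintegralFubini.

(** * Exchanging an iterated integral with an integral in a parameter *)

Section IintFubini.
Context {R : realType} {N : nat} d (T : measurableType d).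
Variable mu : {sigma_finite_measure set T -> \bar R}.
Local Notation leb := (@lebesgue_measure R).
Local Notation V := 'rV[R]_N.
Local Notation B := (borelRV R N).
Variables (A C : R) (n : nat) (w : T -> R) (cs : T -> seq V) (g : T -> V -> R).
Hypothesis A0 : 0 < A.
Hypothesis C0 : 0 <= C.
Hypothesis w0 : forall z, 0 <= w z.
Hypothesis intw : mu.-integrable setT (EFin \o w).
Hypothesis size_cs : forall z, (size (cs z) <= n)%N.
Hypothesis mg : measurable_fun setT (fun p : T * B => g p.1 p.2).
Hypothesis gC : forall z y, `|g z y| <= C * w z * cubes A 0 (cs z) y.

Let mgz z : measurable_fun setT (g z : B -> R).
Proof.
by apply: (measurableT_comp mg (g := fun y : B => ((z, y) : T * B))); exact: measurable_fun_pair.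
Qed.

Let Cw0 z : 0 <= C * w z.
Proof. exact: mulr_ge0. Qed.

Let A2 m : 0 <= (2 * A) ^+ m.
Proof. by rewrite exprn_ge0// mulr_ge0// ltW. Qed.

Lemma dominated_param z : dominated A (g z).
Proof. by split; [exact: mgz|exists (C * w z), (cs z)]. Qed.

Let iint_le m z y : (m <= N)%N ->
  `|iint m (g z) y| <= C * (2 * A) ^+ m * n%:R * w z.
Proof.
move=> mN; apply: le_trans (iint_cubes A0 mN (Cw0 z) (mgz z) (gC z) y) _.
apply: le_trans (_ : _ <= C * w z * (2 * A) ^+ m * n%:R) _; last first.
  by rewrite le_eqVlt; apply/orP; left; apply/eqP; ring.
rewrite ler_wpM2l ?mulr_ge0//.
by apply: le_trans (cubes_le _ _ _ _) _; rewrite ler_nat.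
Qed.

Lemma integrable_iint_param m y : (m <= N)%N ->
  mu.-integrable setT (EFin \o (fun z => iint m (g z) y)).
Proof.
move=> mN; have I := integrableZl measurableT (C * (2 * A) ^+ m * n%:R) intw.
apply: (le_integrable measurableT _ _ I).
  apply/measurable_EFinP.
  apply: (measurableT_comp (measurable_iint m mg) (g := fun z => ((z, y) : T * B))).
  exact: measurable_fun_pair.
move=> z _ /=; rewrite lee_fin; apply: le_trans (iint_le z y mN) _.
exact: ler_norm.
Qed.

Let phi m y (p : R * T) := iint m (g p.2) (upd y m p.1).

Let measurable_phi m y : measurable_fun setT (phi m y).
Proof.
apply: (measurableT_comp (measurable_iint m mg) (g := fun p : R * T => (p.2, upd y m p.1 : B))).
apply: measurable_fun_pair => //.
exact: measurable_upd.
Qed.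

Let integrable_phi m y : (m < N)%N ->
  (leb \x mu)%E.-integrable setT (EFin \o phi m y).
Proof.
move=> mN; have mphi := measurable_phi m y.
apply/integrable21ltyP; first exact/measurable_EFinP.
(* Bound for the mass of a t-slice per unit of [w z]: at most [n] cubes contribute, wherever they
   are, and m + 1 coordinates have been integrated. *)
pose K := C * (2 * A) ^+ m.+1 * n%:R.
have I := integrableZl measurableT K intw.
have [mI bI] := integrableP _ _ _ I.
apply: le_lt_trans bI.
apply: ge0_le_integral => //.
- by move=> z _; exact: integral_ge0.
- have := @measurable_fun_fubini_tonelli_G _ _ _ T R leb (abse \o (EFin \o phi m y)).
  apply => //=.
  by apply: measurableT_comp => //; exact/measurable_EFinP.
- exact: measurableT_comp.
move=> z _ /=.
have C1 : 0 <= C * w z * (2 * A) ^+ m by rewrite mulr_ge0.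
have [I1 I2] := Rintegral_upd_cubes A0 (i := Ordinal mN) y C1 (measurable_iint1 m (mgz z))
  (iint_cubes A0 (ltnW mN) (Cw0 z) (mgz z) (gC z)).
have I3 := integrable_fin_num measurableT (integrable_abse I1).
rewrite /Rintegral in I2; rewrite -(fineK I3) lee_fin; apply: le_trans I2 _.
rewrite ger0_norm; last by rewrite /K !mulr_ge0.
apply: le_trans (_ : _ <= C * w z * (2 * A) ^+ m * (2 * A) * n%:R) _; last first.
  rewrite le_eqVlt; apply/orP; left; apply/eqP; rewrite /K exprSr; ring.
rewrite ler_wpM2l ?mulr_ge0 ?(ltW A0)//.
by apply: le_trans (cubes_le _ _ _ _) _; rewrite ler_nat.
Qed.

(** The mu-integral moves outwards through one Lebesgue integral at a time. The summand [f] is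
    carried along because y -> int g z y dmu(z) need not be dominated by finitely many cubes (the
    operator is nonlocal), so [iintD] could not split it off. *)
Lemma iint_Fubini f m y : (m <= N)%N -> dominated A f ->
  iint m (fun y => f y + \int[mu]_z g z y) y =
  iint m f y + \int[mu]_z iint m (g z) y.
Proof.
move=> + df; elim: m y => //= m IH y mN.
have -> : \int[leb]_t iint m (fun y => f y + \int[mu]_z g z y) (upd y m t) =
    \int[leb]_t (iint m f (upd y m t) + \int[mu]_z iint m (g z) (upd y m t)).
  by apply: eq_Rintegral => t _; exact: IH (ltnW mN).
have I := integrable_phi y mN.
have J1 (t : R) : mu.-integrable setT (EFin \o (fun z => phi m y (t, z))).
  exact: (integrable_iint_param (upd y m t) (ltnW mN)).
have J2 z : leb.-integrable setT (EFin \o (fun t => phi m y (t, z))).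
  exact: (dominated_integrable A0 y (dominated_param z) mN).
rewrite RintegralD//.
- by congr (_ + _); exact: (Rintegral_Fubini I J1 J2).
- exact: (dominated_integrable A0).
- exact: (integrable_Rintegral1 I J1).
Qed.

End IintFubini.

(** * Compact boxes, the Euclidean norm and functions vanishing at infinity *)

Section C0Facts.
Context {R : realType} {N : nat}.
Local Notation V := 'rV[R]_N.

Lemma box_compact (a : V) (r : R) : compact [set y : V | forall i, `|y ord0 i - a ord0 i| <= r].
Proof.
have -> : [set y : V | forall i, `|y ord0 i - a ord0 i| <= r] =
  [set y : V | forall i, `[a ord0 i - r, a ord0 i + r]%classic (y ord0 i)].
  by rewrite predeqE => y; split => H i; have := H i; rewrite /= in_itv /= -ler_distlC distrC.
exact: (@rV_compact R N (fun i => `[a ord0 i - r, a ord0 i + r]%classic)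
           (fun i => @segment_compact _ _ _)).
Qed.

Lemma enorm_ge0 (z : V) : 0 <= enorm z.
Proof. exact: sqrtr_ge0. Qed.

Lemma enorm_sqr (z : V) : enorm z ^+ 2 = \sum_i z ord0 i ^+ 2.
Proof. by rewrite sqr_sqrtr// sumr_ge0// => i _; exact: sqr_ge0. Qed.

Lemma enorm_eq0 (z : V) : (enorm z == 0) = (z == 0).
Proof.
apply/eqP/eqP => [z0|->]; last first.
  by rewrite /enorm big1 ?sqrtr0// => i _; rewrite mxE expr0n.
apply/rowP => i; rewrite mxE; apply/eqP.
have := normr_le_enorm z i; rewrite z0 normr_le0; exact.
Qed.

Lemma C0_bounded (v : V -> R) : C0 v -> exists2 M, 0 <= M & forall x, `|v x| <= M.
Proof.
move=> [cv vv]; have [M0 HM0] := vv 1 ltr01.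
pose S := [set y : V | forall i, `|y ord0 i - (0 : V) ord0 i| <= `|M0|].
have cn : continuous (fun y => `|v y|).
  move=> y; apply: continuous_comp; [exact: cv|exact: norm_continuous].
have S0 : S 0 by move=> i; rewrite subrr normr0.
have [c _ Hc] := EVT_max_rV (ex_intro _ 0 S0) (@box_compact 0 `|M0|) (continuous_subspaceT cn).
exists (Num.max 1 `|v c|); first by rewrite le_max ler01.
move=> x; rewrite le_max; have [xM|xM] := ltP M0 (enorm x).
  by rewrite ltW// HM0.
apply/orP; right; apply: Hc; rewrite inE => i; rewrite mxE subr0.
apply: le_trans (normr_le_enorm x i) _; apply: le_trans xM _; exact: ler_norm.
Qed.

End C0Facts.

(** * The maximum principle *)

Section MaximumPrinciple.
Context {R : realType} {N : nat}.
Local Notation V := 'rV[R]_N.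
Local Notation B := (borelRV R N).

Definition levy_weight (z : V) : R := Num.min (enorm z ^+ 2) 1.

Lemma levy_weight_ge0 z : 0 <= levy_weight z.
Proof. by rewrite le_min sqr_ge0 ler01. Qed.

Lemma continuous_enorm_sqr : continuous (fun x : V => enorm x ^+ 2).
Proof.
have -> : (fun x : V => enorm x ^+ 2) = (fun x : V => \sum_i x ord0 i ^+ 2).
  by apply/funext => x; rewrite enorm_sqr.
elim: (index_enum 'I_N) => [|i r IH].
  by under eq_fun do rewrite big_nil; exact: cst_continuous.
under eq_fun do rewrite big_cons.
move=> y.
apply: (@continuousD _ _ _ (fun x : V => x ord0 i ^+ 2) _); last exact: IH.
apply: (@continuous_comp _ _ _ (fun x : V => x ord0 i) (fun t => t ^+ 2)).
  exact: coord_continuous.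
exact: exprn_continuous.
Qed.

Lemma enorm_le (z : V) (r : R) : 0 <= r -> (forall i, `|z ord0 i| <= r) ->
  enorm z <= N%:R * r.
Proof.
move=> r0 zr.
rewrite -[leRHS]ger0_norm ?mulr_ge0// -sqrtr_sqr; apply: ler_wsqrtr.
apply: le_trans (_ : _ <= N%:R * r ^+ 2) _.
  rewrite [leRHS]mulr_natl -[X in _ *+ X]card_ord -sumr_const; apply: ler_sum => i _.
  by rewrite -[_ ^+ 2]real_normK ?num_real// lerXn2r ?nnegrE.
rewrite exprMn ler_wpM2r ?sqr_ge0// -natrX ler_nat.
by case: (N) => // n; rewrite -[X in (X <= _)%N]muln1 leq_mul2l.
Qed.

Lemma enormD_sqr (x z : V) :
  enorm (x + z) ^+ 2 + enorm (x - z) ^+ 2 = 2 * enorm x ^+ 2 + 2 * enorm z ^+ 2.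
Proof.
rewrite !enorm_sqr !mulr_sumr -!big_split /=; apply: eq_bigr => i _.
by rewrite !mxE; ring.
Qed.

Lemma enormZ (h : R) (z : V) : enorm (h *: z) ^+ 2 = h ^+ 2 * enorm z ^+ 2.
Proof.
by rewrite !enorm_sqr mulr_sumr; apply: eq_bigr => i _; rewrite mxE exprMn.
Qed.

(** If neither shifted point is truncated, the parallelogram identity gives 2|z|^2; if one is, its
    value K alone exceeds 2|x|^2 by at least 1. *)
Lemma truncated_sqr_second_diff (K : R) (x z : V) :
  2 * enorm x ^+ 2 + 1 <= K ->
  Num.min (2 * enorm z ^+ 2) 1 <=
  second_diff (fun y => Num.min (enorm y ^+ 2) K) z x.
Proof.
move=> xK; have D := enormD_sqr x z.
have a0 := sqr_ge0 (enorm (x + z)); have b0 := sqr_ge0 (enorm (x - z)).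
have c0 := sqr_ge0 (enorm x); have d0 := sqr_ge0 (enorm z).
rewrite /second_diff; move: xK D a0 b0 c0 d0.
move: (enorm (x + z) ^+ 2) (enorm (x - z) ^+ 2) (enorm x ^+ 2) (enorm z ^+ 2).
move=> a b c d xK D a0 b0 c0 d0.
have cK : Num.min c K = c by apply/min_idPl; lra.
rewrite cK; case: (leP a K) => ha; case: (leP b K) => hb; case: (leP (2 * d) 1) => hd; lra.
Qed.

Variables (P : nat) (sigma : 'M[R]_(N, P)) (mu : {measure set B -> \bar R}).
Local Notation s_ i := (col i sigma)^T.
Hypothesis intw : mu.-integrable setT (EFin \o (levy_weight : B -> R)).
Hypothesis nontriv : sigma != 0 \/ 0 < \int[mu]_z levy_weight z.
Variables (u S : V -> R).
Hypothesis C0u : C0 u.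
Hypothesis intu : forall x, mu.-integrable setT (EFin \o (fun z : B => second_diff u z x)).
Hypothesis uS : forall x, S x + 2^-1 * \int[mu]_z second_diff u z x = 0.
Hypothesis Sloc : exists C h0 : R, [/\ 0 <= C, 0 < h0 & forall x h, 0 < h <= h0 ->
  `|\sum_(i < P) second_diff u (h *: s_ i) x - h ^+ 2 * S x| <= C * h ^+ 3].

Let max_point x1 : 0 < u x1 -> exists eps x0 : _, 0 < eps /\
  forall z, second_diff u z x0 <= - eps * Num.min (2 * enorm z ^+ 2) 1.
Proof.
move=> u1; have [cu du] := C0u.
have [r0 Hr0] := du (u x1 / 2) (divr_gt0 u1 (ltr0n _ 2)).
pose r := Num.max r0 0.
have r_ge0 : 0 <= r by rewrite le_max lexx orbT.
have Hr x : r < enorm x -> `|u x| < u x1 / 2.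
  by rewrite gt_max => /andP[/Hr0].
(* The least K for which [truncated_sqr_second_diff] applies on the whole ball of radius r, where
   the maximum will lie. *)
pose K := 2 * r ^+ 2 + 1.
have K0 : 0 < K by have := sqr_ge0 r; rewrite /K; lra.
(* The penalty then adds at most u x1 / 4, and outside the ball |u| < u x1 / 2, so F stays below u
   x1 <= F x1 there. *)
pose eps := u x1 / (4 * K).
have eps0 : 0 < eps by rewrite divr_gt0// mulr_gt0.
have epsK : eps * K = u x1 / 4 by rewrite /eps; field; lra.
pose phi (x : V) := Num.min (enorm x ^+ 2) K.
have phi0 x : 0 <= phi x by rewrite le_min sqr_ge0 ltW.
have phiK x : phi x <= K by rewrite ge_min lexx orbT.
pose F x := u x + eps * phi x.
have cF : continuous F.
  move=> y; apply: (@continuousD _ _ _ u (fun x => eps * phi x)); first exact: cu.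
  apply: (@continuousM _ _ (cst eps) phi); first exact: cst_continuous.
  apply: (@continuous_min _ _ (fun x : V => enorm x ^+ 2) (cst K)).
    exact: continuous_enorm_sqr.
  exact: cst_continuous.
have F1 : u x1 <= F x1 by rewrite lerDl mulr_ge0// ltW.
have Fout x : r < enorm x -> F x < u x1.
  move=> /Hr /ltr_normlW ux; rewrite /F.
  have : eps * phi x <= eps * K by rewrite ler_pM2l.
  rewrite epsK; lra.
have in1 : enorm x1 <= r.
  by rewrite leNgt; apply/negP => /Fout; rewrite ltNge F1.
pose D := [set y : V | forall i, `|y ord0 i - (0 : V) ord0 i| <= r].
have inD x : enorm x <= r -> D x.
  by move=> xr i; rewrite mxE subr0; apply: le_trans (normr_le_enorm x i) xr.
have [x0 _ H0] := EVT_max_rV (ex_intro _ x1 (inD _ in1)) (@box_compact _ _ 0 r) (continuous_subspaceT cF).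
have max0 x : F x <= F x0.
  have [xr|xr] := leP (enorm x) r; first by apply: H0; rewrite inE; exact: inD.
  apply: (le_trans (ltW (Fout x xr))); apply: (le_trans F1).
  by apply: H0; rewrite inE; exact: inD.
have in0 : enorm x0 <= r.
  by rewrite leNgt; apply/negP => /Fout; rewrite ltNge (le_trans F1).
exists eps, x0; split => // z.
have xK : 2 * enorm x0 ^+ 2 + 1 <= K.
  by rewrite lerD2r ler_pM2l// lerXn2r// nnegrE sqrtr_ge0.
have := truncated_sqr_second_diff z xK; rewrite -/phi => H.
have := max0 (x0 + z); have := max0 (x0 - z); rewrite /F /second_diff.
move: H; rewrite /second_diff -/(phi _).
rewrite -/(phi (x0 + z)) -/(phi (x0 - z)) -/(phi x0) => /(ler_wpM2l (ltW eps0)).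
move: (Num.min (2 * _) _) => m; lra.
Qed.

Lemma max_principle x : u x <= 0.
Proof.
rewrite leNgt; apply/negP => /max_point[eps [x0 [eps0 H]]].
set I := \int[mu]_z levy_weight z.
have I0 : 0 <= I by apply: Rintegral_ge0 => z _; exact: levy_weight_ge0.
have Iu : \int[mu]_z second_diff u z x0 <= - eps * I.
  rewrite /I -RintegralZl//; apply: le_Rintegral => //.
    exact: (integrableZl measurableT (- eps) intw).
  move=> z _; apply: le_trans (H z) _; rewrite !mulNr lerN2 ler_pM2l//.
  rewrite /levy_weight; move: (enorm z ^+ 2) (sqr_ge0 (enorm z)) => a a0.
  by case: (leP a 1) => ?; case: (leP (2 * a) 1) => ?; lra.
(* The equation bounds S x0 from below through the jump part, while second differences along h *
   sigma_i bound it from above. Together they give eps * I / 2 + 2 * eps * Q <= 0. *)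
have S1 : 2^-1 * (eps * I) <= S x0 by have := uS x0; lra.
pose Q := \sum_(i < P) enorm (s_ i) ^+ 2.
have Q0 : 0 <= Q by apply: sumr_ge0 => i _; exact: sqr_ge0.
have S2 : S x0 <= - (2 * eps * Q).
  have [C [h0 [C0 h00 Hh]]] := Sloc.
  rewrite leNgt; apply/negP => lt.
  pose dl := S x0 + 2 * eps * Q.
  have dl0 : 0 < dl by rewrite /dl; lra.
  (* h <= 1 and h * (2 * Q + 1) <= 1 keep 2 h^2 |sigma_i|^2 at most 1, so the minimum in [H] is its
     quadratic term; the last bound makes C * h smaller than [dl]. *)
  pose h := Num.min h0 (Num.min 1 (Num.min (2 * Q + 1)^-1 (dl / (2 * (C + 1))))).
  have h_gt0 : 0 < h by rewrite !lt_min h00 ltr01 invr_gt0 divr_gt0//; lra.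
  have h_h0 : h <= h0 by rewrite ge_min lexx.
  have h_1 : h <= 1 by rewrite !ge_min lexx !orbT.
  have h_Q : h <= (2 * Q + 1)^-1 by rewrite !ge_min lexx !orbT.
  have h_d : h <= dl / (2 * (C + 1)) by rewrite !ge_min lexx !orbT.
  have hQ : h * (2 * Q + 1) <= 1 by rewrite -ler_pdivlMr ?mul1r//; lra.
  have hd : h * (2 * (C + 1)) <= dl by rewrite -ler_pdivlMr//; lra.
  have /Hh : 0 < h <= h0 by rewrite h_gt0.
  move=> /(_ x0) A.
  have A2 : \sum_(i < P) second_diff u (h *: s_ i) x0 <= - eps * (2 * h ^+ 2 * Q).
    rewrite /Q !mulr_sumr; apply: ler_sum => i _.
    apply: le_trans (H _) _; rewrite !mulNr lerN2 ler_pM2l// enormZ mulrA le_min lexx /=.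
    have qQ : enorm (s_ i) ^+ 2 <= Q.
      by rewrite /Q (bigD1 i)//= lerDl; apply: sumr_ge0 => j _; exact: sqr_ge0.
    apply: le_trans (_ : _ <= h * (2 * Q)) _; last by lra.
    have : h * (h * enorm (s_ i) ^+ 2) <= h * Q.
      rewrite ler_pM2l//; apply: le_trans qQ.
      by rewrite ler_piMl// sqr_ge0.
    lra.
  have h2 : 0 < h ^+ 2 by rewrite exprn_gt0.
  have B1 : h ^+ 2 * dl <= C * h ^+ 3.
    by move: A => /ler_normlP[A _]; rewrite /dl; lra.
  have B2 : dl <= C * h.
    by rewrite -(ler_pM2l h2); apply: le_trans B1 _; rewrite exprSr; lra.
  have : 0 < h * C + h * 2 by rewrite ltr_wpDl ?mulr_gt0// mulr_ge0// ltW.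
  lra.
case: nontriv => [sigma0|Ipos]; last first.
  have : 0 < eps * I by rewrite mulr_gt0.
  have : 0 <= eps * Q by rewrite mulr_ge0// ltW.
  lra.
have Qpos : 0 < Q.
  rewrite lt_neqAle Q0 andbT; apply: contra sigma0 => /eqP Q00.
  apply/eqP/matrixP => j i; rewrite mxE; apply/eqP.
  have : enorm (s_ i) ^+ 2 <= 0.
    rewrite Q00 /Q (bigD1 i)//= lerDl; apply: sumr_ge0 => k _; exact: sqr_ge0.
  rewrite enorm_sqr (bigD1 j)//= !mxE => le0.
  have : 0 <= \sum_(k < N | k != j) s_ i ord0 k ^+ 2 by apply: sumr_ge0 => k _; exact: sqr_ge0.
  move=> sum0; have := sqr_ge0 (sigma j i) => sq0.
  have /eqP : sigma j i ^+ 2 = 0 by lra.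
  by rewrite expf_eq0.
have : 0 < eps * Q by rewrite mulr_gt0.
have : 0 <= eps * I by rewrite mulr_ge0// ltW.
lra.
Qed.

End MaximumPrinciple.

(** * Mollification of a function vanishing at infinity *)

Section MolliBounds.
Context {R : realType} {N : nat}.
Local Notation V := 'rV[R]_N.
Local Notation B := (borelRV R N).
Variable lam : R.
Hypothesis lam0 : 0 < lam.
(* Half-width of a cube around [x] containing the support of [rho x] and of its
   translates by vectors of length at most [1]. *)
Local Notation A := (lam^-1 + 1).
Local Notation rho := (molli lam).

Lemma halfwidth_gt0 : 0 < A.
Proof. by rewrite addr_gt0// invr_gt0. Qed.

Lemma cube_in r m (c y : V) : (forall i, `|y ord0 i - c ord0 i| <= r) -> cube r m c y = 1.
Proof.
move=> H; rewrite /cube big1// => i _; rewrite indicE mem_set//=.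
by rewrite in_itv /= -ler_distlC distrC.
Qed.

Lemma cube_dec r (c y : V) : (forall i, `|y ord0 i - c ord0 i| <= r) \/
  exists i, r < `|y ord0 i - c ord0 i|.
Proof.
have [/forallP H|/forallPn[i]] := boolP [forall i, `|y ord0 i - c ord0 i| <= r].
  by left.
by rewrite -ltNge => H; right; exists i.
Qed.

Lemma cubes1 r m (c y : V) : cubes r m [:: c] y = cube r m c y.
Proof. by rewrite /cubes big_seq1. Qed.

Lemma le_cube_of_supp (f K : R) (c y : V) : 0 <= K ->
  ((exists i, A < `|y ord0 i - c ord0 i|) -> f = 0) ->
  `|f| <= K -> `|f| <= K * cube A 0 c y.
Proof.
move=> K0 f0 fK; have [H|H] := cube_dec A c y.
  by rewrite cube_in// mulr1.
by rewrite f0// normr0 mulr_ge0// cube_ge0.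
Qed.

Lemma molli_supp1 (x y : V) s i : A < `|y ord0 i - x ord0 i| -> rho x s y = 0.
Proof.
move=> H; have H' : lam^-1 <= `|y ord0 i - x ord0 i|.
  by apply: le_trans (ltW H); rewrite lerDl.
exact: (molli_supp lam0 s H').
Qed.

Lemma molli_le_cube s : exists2 K, 0 <= K & forall x y : V,
  `|rho x s y| <= K * cube A 0 x y.
Proof.
have [K K0 HK] := @molli_bounded R N lam lam0 s; exists K => // x y.
apply: le_cube_of_supp => // -[i Hi]; exact: molli_supp1 Hi.
Qed.

Lemma molli_shift0 (x : V) s (y z : V) i : enorm z <= 1 -> A < `|y ord0 i - x ord0 i| ->
  rho x s (y + z) = 0.
Proof.
move=> z1 H; suff : lam^-1 <= `|(y + z) ord0 i - x ord0 i| by exact: molli_supp.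
rewrite mxE; have zi := le_trans (normr_le_enorm z i) z1.
have := ler_normB (y ord0 i + z ord0 i - x ord0 i) (z ord0 i).
rewrite (_ : _ - z ord0 i = y ord0 i - x ord0 i); last by ring.
lra.
Qed.

Lemma enormN (z : V) : enorm (- z) = enorm z.
Proof.
by rewrite /enorm; congr Num.sqrt; apply: eq_bigr => i _; rewrite mxE sqrrN.
Qed.

Lemma second_diff_supp (x y z : V) : enorm z <= 1 ->
  (exists i, A < `|y ord0 i - x ord0 i|) -> second_diff (rho x [::]) z y = 0.
Proof.
move=> z1 [i Hi]; rewrite /second_diff (molli_shift0 _ z1 Hi).
have z1' : enorm (- z) <= 1 by rewrite enormN.
by rewrite (molli_shift0 _ z1' Hi) (molli_supp1 _ Hi) mulr0 addr0 subr0.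
Qed.

Lemma dmolli_supp1 n (x y z : V) :
  (exists i, A < `|y ord0 i - x ord0 i|) -> dmolli lam x z n [::] y = 0.
Proof.
move=> [i Hi]; suff : lam^-1 <= `|y ord0 i - x ord0 i| by exact: dmolli_supp.
by apply: le_trans (ltW Hi); rewrite lerDl.
Qed.

Lemma second_diff_molliE (x y z : V) : second_diff (rho x [::]) z y =
  rho (x - z) [::] y + rho (x + z) [::] y - 2 * rho x [::] y.
Proof. by rewrite /second_diff !(addrC y) !molli_shift opprK. Qed.

(** For |z| <= 1 the Taylor bound gives |z|^2, and the cube around x contains all three translates
    of the support. For |z| > 1 the three bumps are bounded separately, each in its own cube. *)
Lemma second_diff_le_cubes : exists2 K, 0 <= K & forall x z y : V,
  `|second_diff (rho x [::]) z y| <=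
  K * levy_weight z * cubes A 0 [:: x; x - z; x + z] y.
Proof.
have [K1 K10 H1] := @molli_second_diff_le R N lam lam0.
have [K2 K20 H2] := molli_le_cube [::].
exists (K1 + 2 * K2); first by rewrite addr_ge0// mulr_ge0.
move=> x z y; rewrite /cubes !big_cons big_nil addr0.
have c0 c : 0 <= cube A 0 c y by exact: cube_ge0.
rewrite /levy_weight; have [z1|z1] := leP (enorm z) 1.
  have -> : Num.min (enorm z ^+ 2) 1 = enorm z ^+ 2.
    by apply/min_idPl; rewrite expr_le1// enorm_ge0.
  have K1z : 0 <= K1 * enorm z ^+ 2 by rewrite mulr_ge0// sqr_ge0.
  have := le_cube_of_supp K1z (second_diff_supp z1) (H1 x z y).
  move=> /le_trans; apply; apply: ler_pM; rewrite ?c0//.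
    by rewrite ler_wpM2r ?sqr_ge0// lerDl mulr_ge0.
  by rewrite lerDl addr_ge0.
have -> : Num.min (enorm z ^+ 2) 1 = 1.
  by apply/min_idPr; rewrite expr_ge1// ?enorm_ge0// ltW.
rewrite second_diff_molliE mulr1.
apply: le_trans (_ : _ <= K2 * cube A 0 (x - z) y + K2 * cube A 0 (x + z) y + 2 * (K2 * cube A 0 x y)) _.
  apply: le_trans (ler_normB _ _) _; apply: lerD.
    by apply: le_trans (ler_normD _ _) _; apply: lerD.
  by rewrite normrM ger0_norm// ler_wpM2l.
have := c0 x; have := c0 (x - z); have := c0 (x + z).
move: (cube A 0 x y) (cube A 0 (x - z) y) (cube A 0 (x + z) y) => a b c.
nra.
Qed.

Lemma local_le_cube : exists2 K, 0 <= K & forall x z y : V, enorm z <= 1 ->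
  `|second_diff (rho x [::]) z y - dmolli lam x z 2 [::] y| <=
  K * enorm z ^+ 3 * cube A 0 x y.
Proof.
have [K K0 HK] := @molli_second_diff_taylor R N lam lam0; exists K => // x z y z1.
apply: le_cube_of_supp => //; first by rewrite mulr_ge0// exprn_ge0// enorm_ge0.
by move=> H; rewrite second_diff_supp// dmolli_supp1// subrr.
Qed.

Lemma dmolli_le_cube n : exists2 K, 0 <= K & forall x z y : V,
  `|dmolli lam x z n [::] y| <= K * enorm z ^+ n * cube A 0 x y.
Proof.
have [K K0 HK] := @dmolli_bounded R N lam lam0 n [::]; exists K => // x z y.
apply: le_cube_of_supp => //; first by rewrite mulr_ge0// exprn_ge0// enorm_ge0.
by move=> H; rewrite dmolli_supp1.
Qed.

Lemma diff_le_cube : exists2 K, 0 <= K & forall x z y : V, enorm z <= 1 ->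
  `|rho x [::] (y + z) - rho x [::] y| <= K * enorm z * cube A 0 x y.
Proof.
have [K K0 HK] := @molli_diff_le R N lam lam0; exists K => // x z y z1.
apply: le_cube_of_supp => //; first by rewrite mulr_ge0// enorm_ge0.
move=> [i Hi]; rewrite (molli_shift0 _ z1 Hi) (molli_supp1 _ Hi).
by rewrite subrr.
Qed.

Lemma continuous_dmolli x z n s : continuous (dmolli lam x z n s : V -> R).
Proof.
elim: n s => [|n IH] s; first exact: molli_continuous.
rewrite /=; elim: (index_enum 'I_N) => [|i r IHr].
  by under eq_fun do rewrite big_nil; exact: cst_continuous.
under eq_fun do rewrite big_cons.
move=> y; apply: (@continuousD _ _ _ (fun y => z ord0 i * dmolli lam x z n (i :: s) y) _); last exact: IHr.
by apply: (@continuousM _ _ (cst (z ord0 i)) (dmolli lam x z n (i :: s))); [exact: cst_continuous|exact: IH].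
Qed.

End MolliBounds.

Section Mollification.
Context {R : realType} {N : nat}.
Local Notation V := 'rV[R]_N.
Local Notation B := (borelRV R N).
Variables (lam : R) (v : V -> R).
Hypothesis lam0 : 0 < lam.
Hypothesis C0v : C0 v.
Local Notation A := (lam^-1 + 1).
Local Notation rho := (molli lam).
Local Notation A0 := (halfwidth_gt0 lam0).

(** The bump has positive but unnormalised mass: [eq0_of_mollify] relies on its sign and on its
    lower bound near the centre. *)
Definition mollify (x : V) : R := intRN (fun y => v y * rho x [::] y).

Let measurable_v : measurable_fun setT (v : B -> R).
Proof. by apply: continuous_measurable_rV; case: C0v. Qed.

Lemma dominated_mul (f : V -> R) x K : continuous f -> 0 <= K ->
  (forall y, `|f y| <= K * cube A 0 x y) -> dominated A (fun y => v y * f y).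
Proof.
move=> cf K0 fK; split.
  by apply: measurable_funM => //; exact: continuous_measurable_rV.
have [M M0 HM] := C0_bounded C0v.
exists (M * K), [:: x]; split; first exact: mulr_ge0.
by move=> y; rewrite cubes1 normrM -mulrA ler_pM.
Qed.

Lemma dominated_mollify x : dominated A (fun y => v y * rho x [::] y).
Proof.
have [K K0 HK] := @molli_le_cube R N lam lam0 [::].
by apply: (@dominated_mul _ x K) => //; exact: molli_continuous.
Qed.

Lemma dominated_dmolli x z n : dominated A (fun y => v y * dmolli lam x z n [::] y).
Proof.
have [K K0 HK] := @dmolli_le_cube R N lam lam0 n.
apply: (@dominated_mul _ x (K * enorm z ^+ n)) => //; first exact: continuous_dmolli.
by rewrite mulr_ge0// exprn_ge0// enorm_ge0.
Qed.

Let dominated_comb x a b c : dominated A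
  (fun y => v y * rho a [::] y + (v y * rho b [::] y + (-2) * (v y * rho x [::] y))) /\
  intRN (fun y => v y * rho a [::] y + (v y * rho b [::] y + c * (v y * rho x [::] y))) =
  mollify a + (mollify b + c * mollify x).
Proof.
have D d : dominated A (fun y => v y * rho b [::] y + d * (v y * rho x [::] y)).
  apply: dominatedD; first exact: dominated_mollify.
  apply: dominatedZ; exact: dominated_mollify.
split; first by apply: dominatedD => //; exact: dominated_mollify.
rewrite /intRN (iintD A0)//; last exact: dominated_mollify.
rewrite (iintD A0)//; [|exact: dominated_mollify|by apply: dominatedZ; exact: dominated_mollify].
by rewrite (iintZ A0)//; exact: dominated_mollify.
Qed.

Let second_diffE x z : (fun y => v y * second_diff (rho x [::]) z y) =
  (fun y => v y * rho (x - z) [::] y + (v y * rho (x + z) [::] y + (-2) * (v y * rho x [::] y))).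
Proof. by apply/funext => y; rewrite second_diff_molliE; ring. Qed.

Lemma dominated_second_diff x z : dominated A (fun y => v y * second_diff (rho x [::]) z y).
Proof. by rewrite second_diffE; have [] := dominated_comb x (x - z) (x + z) 0. Qed.

Lemma intRN_second_diff x z :
  intRN (fun y => v y * second_diff (rho x [::]) z y) = second_diff mollify z x.
Proof.
rewrite second_diffE; have [_ ->] := dominated_comb x (x - z) (x + z) (-2).
rewrite /second_diff; ring.
Qed.

Lemma intRN_le (f : V -> R) K x : measurable_fun setT (f : B -> R) -> 0 <= K ->
  (forall y, `|f y| <= K * cube A 0 x y) -> `|intRN f| <= K * (2 * A) ^+ N.
Proof.
move=> mf K0 fK.
have fK' y : `|f y| <= K * cubes A 0 [:: x] y by rewrite cubes1.
apply: le_trans (iint_cubes A0 (leqnn N) K0 mf fK' 0) _.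
by rewrite cubes1 ler_piMr ?cube_le1// mulr_ge0// exprn_ge0// mulr_ge0// ltW// A0.
Qed.

(** The shift is moved onto the bump, whose Lipschitz bound does the work; v contributes only its
    supremum. *)
Lemma mollify_diff_le : exists2 K, 0 <= K & forall x z : V, enorm z <= 1 ->
  `|mollify (x - z) - mollify x| <= K * enorm z.
Proof.
have [M M0 HM] := C0_bounded C0v.
have [K K0 HK] := @diff_le_cube R N lam lam0.
have V0 : 0 <= (2 * A) ^+ N by rewrite exprn_ge0// mulr_ge0// ltW// A0.
exists (M * K * (2 * A) ^+ N); first by rewrite !mulr_ge0.
move=> x z z1.
have E : mollify (x - z) - mollify x =
    intRN (fun y => v y * rho (x - z) [::] y + (-1) * (v y * rho x [::] y)).
  rewrite /intRN (iintD A0)//; [|exact: dominated_mollify|by apply: dominatedZ; exact: dominated_mollify].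
  by rewrite (iintZ A0) ?mulN1r//; exact: dominated_mollify.
have D : dominated A (fun y => v y * rho (x - z) [::] y + (-1) * (v y * rho x [::] y)).
  apply: dominatedD; first exact: dominated_mollify.
  by apply: dominatedZ; exact: dominated_mollify.
rewrite E mulrAC.
apply: (@intRN_le _ _ x); [by case: D|by rewrite !mulr_ge0// enorm_ge0|move=> y].
rewrite (_ : _ + _ = v y * (rho x [::] (y + z) - rho x [::] y)); last first.
  by rewrite (addrC y) molli_shift; ring.
by rewrite normrM -!mulrA ler_pM// mulrA HK.
Qed.

Lemma mollify_C0 : C0 mollify.
Proof.
split.
  have [K K0 HK] := mollify_diff_le.
  move=> x; apply/(@cvgrPdist_le _ _ _ (nbhs (x : V)) (nbhs_filter x) mollify) => e e0.
  have c : (fun y : V => enorm (x - y)) y @[y --> x] --> (0 : R).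
    have -> : (0 : R) = enorm (x - x) by rewrite subrr; apply/esym/eqP; rewrite enorm_eq0.
    apply: (@continuous_comp _ _ _ (fun y : V => x - y) (@enorm R N)).
      apply: (@continuousB _ _ _ (cst x) id); [exact: cst_continuous|exact: cvg_id].
    have -> : @enorm R N = (fun z => Num.sqrt (enorm z ^+ 2)).
      by apply/funext => z; rewrite sqrtr_sqr ger0_norm ?enorm_ge0.
    apply: continuous_comp; [exact: continuous_enorm_sqr|exact: sqrt_continuous].
  have e1 : 0 < Num.min 1 (e / (K + 1)) by rewrite lt_min ltr01 divr_gt0//; lra.
  move/(@cvgrPdist_le _ _ _ (nbhs (x : V)) (nbhs_filter x)) : c => /(_ _ e1); apply: filterS => y.
  rewrite sub0r normrN ger0_norm ?enorm_ge0// le_min => /andP[n1 n2].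
  have := HK x (x - y) n1; rewrite subKr distrC => /le_trans; apply.
  move: n2; rewrite ler_pdivlMr; last by lra.
  have := enorm_ge0 (x - y); nra.
move=> eps eps0.
have [K K0 HK] := @molli_le_cube R N lam lam0 [::].
have V0 : 0 <= (2 * A) ^+ N by rewrite exprn_ge0// mulr_ge0// ltW// A0.
(* The extra 1 makes W positive and the final bound strictly smaller than d * W = eps. *)
pose W := K * (2 * A) ^+ N + 1.
have W0 : 0 < W by rewrite /W ltr_wpDl// mulr_ge0.
pose d := eps / W.
have d0 : 0 < d by rewrite divr_gt0.
have [M HM] := C0v.2 d d0.
exists (N%:R * (`|M| + A)) => x xM.
have MA : 0 <= `|M| + A by rewrite addr_ge0// ltW// A0.
(* [enorm] is at most N times the largest coordinate, so some coordinate of x exceeds |M| + A; every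
   y in the cube around x then has norm above M, where v is small. *)
have [i Hi] : exists i, `|M| + A < `|x ord0 i|.
  have [H|[i]] := cube_dec (`|M| + A) 0 x; last by rewrite mxE subr0; exists i.
  have H' i : `|x ord0 i| <= `|M| + A by have := H i; rewrite mxE subr0.
  by have := enorm_le MA H'; rewrite leNgt xM.
apply: le_lt_trans (_ : d * K * (2 * A) ^+ N < eps); last first.
  have <- : d * W = eps by rewrite /d divfK// gt_eqF.
  by rewrite -mulrA ltr_pM2l// /W ltrDl.
apply: (@intRN_le _ _ x); [by case: (dominated_mollify x)|by rewrite mulr_ge0// ltW|move=> y].
apply: le_cube_of_supp => //; first by rewrite mulr_ge0// ltW.
  by move=> [j Hj]; rewrite (molli_supp1 _ _ Hj) ?mulr0.
rewrite normrM; have [K1 | H] := cube_dec A x y; last first.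
  by move: H => [j Hj]; rewrite (molli_supp1 _ _ Hj)// normr0 mulr0 mulr_ge0// ltW.
have yM : M < enorm y.
  apply: lt_le_trans (normr_le_enorm y i); apply: le_lt_trans (ler_norm M) _.
  have := ler_normB (x ord0 i - y ord0 i) (- y ord0 i); rewrite opprK subrK normrN.
  have := K1 i; rewrite distrC; lra.
apply: ler_pM => //; first exact: ltW (HM y yM).
by apply: le_trans (HK x y) _; rewrite ler_piMr// cube_le1.
Qed.


(** The order-3 Taylor error of the bump, integrated against v over one cube. The bound h <= 1 / (1
    + Q) gives |h sigma_i| <= 1, which confines everything to the cube around x. *)
Lemma second_diff_local P (sigma : 'M[R]_(N, P)) :
  exists C h0 : R, [/\ 0 <= C, 0 < h0 & forall x h, 0 < h <= h0 ->
  `|\sum_(i < P) second_diff mollify (h *: (col i sigma)^T) x -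
    h ^+ 2 * intRN (fun y => \sum_(i < P) v y * dmolli lam x (col i sigma)^T 2 [::] y)|
  <= C * h ^+ 3].
Proof.
have [M M0 HM] := C0_bounded C0v.
have [K K0 HK] := @local_le_cube R N lam lam0.
have V0 : 0 <= (2 * A) ^+ N by rewrite exprn_ge0// mulr_ge0// ltW// A0.
pose s i := (col i sigma)^T.
pose Q := \sum_(i < P) enorm (s i).
have Q0 : 0 <= Q by apply: sumr_ge0 => i _; exact: enorm_ge0.
have Qi i : enorm (s i) <= Q.
  by rewrite /Q (bigD1 i)//= lerDl; apply: sumr_ge0 => j _; exact: enorm_ge0.
exists (\sum_(i < P) (M * (K * Q ^+ 3)) * (2 * A) ^+ N), (1 + Q)^-1; split.
- by apply: sumr_ge0 => i _; rewrite !mulr_ge0// exprn_ge0.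
- by rewrite invr_gt0 ltr_pwDl.
move=> x h /andP[h0 hQ].
have hs i : enorm (h *: s i) = h * enorm (s i).
  by apply/eqP; rewrite -(@eqrXn2 _ 2)// ?enorm_ge0 ?mulr_ge0 ?enorm_ge0 ?(ltW h0)// enormZ exprMn.
have hs1 i : enorm (h *: s i) <= 1.
  rewrite hs; apply: le_trans (_ : _ <= h * (1 + Q)) _.
    by rewrite ler_pM2l// (le_trans (Qi i))// lerDr.
  by rewrite -ler_pdivlMr ?mul1r ?ltr_pwDl.
rewrite /intRN (iint_sum A0 0 (leqnn N) (fun i => dominated_dmolli x (s i) 2)).
rewrite mulr_sumr -sumrB mulr_suml.
apply: le_trans (ler_norm_sum _ _ _) _; apply: ler_sum => i _.
have D1 := dominated_second_diff x (h *: s i).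
have D2 := dominatedZ (- h ^+ 2) (dominated_dmolli x (s i) 2).
rewrite -intRN_second_diff /intRN -mulNr -(iintZ A0 _ _ (leqnn N) (dominated_dmolli x (s i) 2)).
rewrite -(iintD A0 _ (leqnn N) D1 D2).
have [mD _] := dominatedD D1 D2.
rewrite mulrAC; apply: (@intRN_le _ _ x) => //.
  by rewrite !mulr_ge0 ?exprn_ge0 ?(ltW h0).
move=> y.
rewrite (_ : _ + _ = v y * (second_diff (rho x [::]) (h *: s i) y -
    dmolli lam x (h *: s i) 2 [::] y)); last first.
  by rewrite dmolliZ; ring.
have hs3 : enorm (h *: s i) ^+ 3 <= Q ^+ 3 * h ^+ 3.
  rewrite hs exprMn mulrC ler_wpM2r//; first by rewrite exprn_ge0// ltW.
  by apply: lerXn2r => //; rewrite nnegrE enorm_ge0.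
apply: le_trans (_ : _ <= M * (K * (Q ^+ 3 * h ^+ 3) * cube A 0 x y)) _; last first.
  by rewrite le_eqVlt; apply/orP; left; apply/eqP; ring.
rewrite normrM; apply: ler_pM => //; apply: le_trans (HK x _ y (hs1 i)) _.
by rewrite ler_wpM2r ?cube_ge0// ler_wpM2l.
Qed.

End Mollification.

(** * Symmetric Levy measures *)

Section LevyMeasure.
Context {R : realType} {N : nat}.
Local Notation V := 'rV[R]_N.
Local Notation B := (borelRV R N).
Local Notation w := (levy_weight : B -> R).
Variable mu : {measure set B -> \bar R}.
Hypothesis hmu0 : mu [set (0 : V)] = 0%E.
Hypothesis hsym : forall A : set B, measurable A -> mu [set - (z : V) | z in A] = mu A.
Hypothesis hlevy : (\int[mu]_(z in ~` [set (0%R : V)])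
  (Num.min (enorm z ^+ 2) 1)%R%:E < +oo)%E.

Lemma measurable_levy_weight : measurable_fun setT w.
Proof.
by apply: measurable_minr => //; apply: measurable_funX; exact: measurable_enorm.
Qed.

Lemma open_setC0 : open (~` [set (0 : V)]).
Proof.
apply: closed_openC; apply: compact_closed; last exact: compact_set1.
exact: norm_hausdorff.
Qed.

Lemma measurable_setC0 : measurable (~` [set (0 : V)] : set B).
Proof. apply: sub_sigma_algebra; exact: open_setC0. Qed.

Lemma measurable_set0 : measurable ([set (0 : V)] : set B).
Proof. by rewrite -[X in measurable X]setCK; apply: measurableC; exact: measurable_setC0. Qed.

Lemma restrict_setC0 (f : V -> R) : f 0 = 0 -> (f \_ (~` [set (0 : V)])) = f.
Proof.
move=> f0; apply/funext => z; rewrite patchE; case: ifPn => // /negP zD.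
have [->//|z0] := eqVneq z 0; exfalso; apply: zD; rewrite inE => /eqP.
by rewrite (negbTE z0).
Qed.

Lemma levy_weight0 : levy_weight (0 : V) = 0.
Proof.
rewrite /levy_weight (_ : enorm 0 = 0); last by apply/eqP; rewrite enorm_eq0.
by rewrite expr0n; apply/min_idPl.
Qed.

Lemma levy_weight_gt0 (z : V) : z != 0 -> 0 < levy_weight z.
Proof.
rewrite -enorm_eq0 => z0; rewrite lt_min ltr01 andbT exprn_gt0//.
by rewrite lt_neqAle eq_sym z0 enorm_ge0.
Qed.

Lemma levy_weightN (z : V) : levy_weight (- z) = levy_weight z.
Proof. by rewrite /levy_weight enormN. Qed.

Lemma integrable_levy_weight : mu.-integrable setT (EFin \o w).
Proof.
apply/integrableP; split; first by apply/measurable_EFinP; exact: measurable_levy_weight.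
move: hlevy; rewrite integral_mkcond.
congr (_ < _)%E; apply: eq_integral => z _.
rewrite restrict_EFin /= (restrict_setC0 levy_weight0) ger0_norm//.
exact: levy_weight_ge0.
Qed.

(** By the Markov inequality the sets where the weight is at least 1/(n+1) have finite measure. They
    exhaust everything but the origin, which is adjoined as a null set. *)
Lemma levy_sigma_finite : sigma_finite setT mu.
Proof.
pose S (n : nat) : set B := setT `&` [set z | (n.+1%:R^-1%:E <= `|(EFin \o w) z|)%E].
have mw : measurable_fun setT (EFin \o w) by apply/measurable_EFinP; exact: measurable_levy_weight.
have mS n : measurable (S n).
  by apply: emeasurable_fun_c_infty => //; exact: measurableT_comp.
exists (fun n => S n `|` [set (0 : V)]).
  rewrite predeqE => z; split=> // _; have [->|z0] := eqVneq z (0 : V).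
    by exists 0%N => //; right.
  have [n] := ltr_add_invr (levy_weight_gt0 z0); rewrite add0r => nz.
  exists n => //; left; split => //=; rewrite lee_fin ger0_norm ?levy_weight_ge0//.
  exact: ltW.
move=> n; split; first by apply: measurableU; [exact: mS|exact: measurable_set0].
apply: le_lt_trans (measureU2 _ (mS n) measurable_set0) _.
rewrite [X in (_ + X)%E](_ : _ = 0%E) ?adde0; last exact: hmu0.
have n0 : 0 < n.+1%:R^-1 :> R by rewrite invr_gt0.
have := le_integral_abse mu measurableT mw n0.
have /integrableP[_ /[swap]] := integrable_levy_weight.
move=> /le_lt_trans /[apply].
rewrite -/(S n) => H.
rewrite ltNge leye_eq; apply/negP => /eqP E.
by move: H; rewrite E gt0_muley ?lte_fin// ltxx.
Qed.

(** Change of variables along z -> -z: image and preimage of a set under this involution coincide,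
    so [hsym] says that mu is its own pushforward. *)
Lemma Rintegral_symmetric (f : B -> R) : measurable_fun setT f ->
  mu.-integrable setT (EFin \o (fun z : B => f (- (z : V)))) ->
  \int[mu]_z f z = \int[mu]_z f (- (z : V)).
Proof.
move=> mf If; pose opp (z : B) : B := - (z : V).
have mopp : measurable_fun setT opp by exact: measurable_oppr.
have mf' : measurable_fun setT (EFin \o f) by exact/measurable_EFinP.
have := @integral_pushforward _ _ B B R opp mopp mu setT (EFin \o f) mf'.
rewrite preimage_setT => /(_ If measurableT) E.
rewrite /Rintegral; congr fine; rewrite -[RHS]E.
apply: eq_measure_integral => C mC _; rewrite /pushforward -(hsym mC); congr (mu _).
rewrite predeqE => z; split => [[y Cy <-]|Cz]; first by rewrite /opp /= opprK.
by exists (opp z) => //; rewrite /opp opprK.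
Qed.

Section LmuMolli.
Variable lam : R.
Hypothesis lam0 : 0 < lam.
Local Notation rho := (molli lam).

Let k (x y z : V) : R := rho x [::] (y + z) - rho x [::] y -
  dmolli lam x z 1 [::] y * (if enorm z <= 1 then 1 else 0).

Let measurable_k x y : measurable_fun setT (k x y : B -> R).
Proof.
have mr : measurable_fun setT (fun z : B => rho x [::] (y + (z : V))).
  apply: (measurableT_comp (continuous_measurable_rV (@molli_continuous R N lam x [::]))
    (g := fun z : B => y + (z : V) : B)).
  by apply: measurable_addr; [exact: measurable_cst|exact: measurable_id].
apply: measurable_funB; first by apply: measurable_funB => //; exact: measurable_cst.
apply: measurable_funM.
  apply: measurable_sum => i; apply: measurable_funM; first exact: measurable_coord.
  exact: measurable_cst.
apply: measurable_fun_ifT; [|exact: measurable_cst..].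
by apply: measurable_fun_ler; [exact: measurable_enorm|exact: measurable_cst].
Qed.

Let k_le : exists2 K, 0 <= K & forall x y z : V, `|k x y z| <= K * levy_weight z.
Proof.
have [K1 K10 H1] := @molli_taylor2 R N lam lam0.
have [K2 K20 H2] := @molli_bounded R N lam lam0 [::].
exists (K1 + 2 * K2); first by rewrite addr_ge0// mulr_ge0.
move=> x y z; rewrite /k /levy_weight; case: ifPn => z1.
  have -> : Num.min (enorm z ^+ 2) 1 = enorm z ^+ 2.
    by apply/min_idPl; rewrite expr_le1// enorm_ge0.
  rewrite mulr1; apply: le_trans (H1 x z y) _.
  by rewrite ler_wpM2r ?sqr_ge0// lerDl mulr_ge0.
have -> : Num.min (enorm z ^+ 2) 1 = 1.
  by apply/min_idPr; rewrite expr_ge1// ?enorm_ge0// ltW// ltNge.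
rewrite mulr0 subr0 mulr1; apply: le_trans (ler_normB _ _) _.
by have := H2 x (y + z); have := H2 x y; lra.
Qed.

Let integrable_k x y : mu.-integrable setT (EFin \o (k x y : B -> R)).
Proof.
have [K K0 HK] := k_le.
apply: (le_integrable measurableT _ _ (integrableZl measurableT K integrable_levy_weight)).
  exact/measurable_EFinP.
move=> z _ /=; rewrite lee_fin; apply: le_trans (HK x y z) _; exact: ler_norm.
Qed.

Let integrable_kN x y : mu.-integrable setT (EFin \o (fun z : B => k x y (- (z : V)))).
Proof.
have [K K0 HK] := k_le.
apply: (le_integrable measurableT _ _ (integrableZl measurableT K integrable_levy_weight)).
  apply/measurable_EFinP; apply: (measurableT_comp (measurable_k x y)).
  exact: measurable_oppr.
move=> z _ /=; rewrite lee_fin; apply: le_trans (HK x y (- z)) _.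
rewrite levy_weightN; exact: ler_norm.
Qed.

(** The compensator [dmolli x z 1] is odd in z, so it cancels in k z + k (-z), which is the second
    difference. The bound of k by [levy_weight] makes both halves integrable. *)
Lemma Lmu_molli x y : Lmu mu (rho x [::]) y =
  2^-1 * \int[mu]_z second_diff (rho x [::]) z y.
Proof.
have -> : Lmu mu (rho x [::]) y = \int[mu]_z k x y z.
  have kE : (fun z : V => rho x [::] (y + z) - rho x [::] y -
      derive (rho x [::]) y z * (if enorm z <= 1 then 1 else 0)) = k x y.
    by apply/funext => z; rewrite /k derive_molli.
  (* As k vanishes at the origin, integrating over the complement of 0 or over the whole space gives
     the same value. *)
  have k0 : k x y 0 = 0.
    by rewrite /k addr0 subrr /= big1 ?mul0r ?subr0// => i _; rewrite mxE mul0r.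
  by rewrite /Lmu kE Rintegral_mkcond restrict_setC0.
have E : \int[mu]_z second_diff (rho x [::]) z y = \int[mu]_z k x y z + \int[mu]_z k x y (- (z : V)).
  rewrite -RintegralD//; apply: eq_Rintegral => z _.
  rewrite /k enormN /second_diff -scaleN1r (dmolliZ lam x z 1 [::] y (-1)) expr1 scaleN1r.
  by case: ifP => _; ring.
rewrite E -Rintegral_symmetric//; first by field.
Qed.

End LmuMolli.

End LevyMeasure.

(** * The Liouville theorem *)

Section Liouville.
Context {R : realType} {N P : nat}.
Local Notation V := 'rV[R]_N.
Local Notation B := (borelRV R N).
Variable sigma : 'M[R]_(N, P).
Variable mu : {sigma_finite_measure set B -> \bar R}.
Hypothesis hsym : forall A : set B, measurable A -> mu [set - (z : V) | z in A] = mu A.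
Hypothesis hlevy : (\int[mu]_(z in ~` [set (0%R : V)])
  (Num.min (enorm z ^+ 2) 1)%R%:E < +oo)%E.
Variable v : V -> R.
Hypothesis C0v : C0 v.
Hypothesis hdist : forall psi : V -> R, Cc_inf psi ->
  intRN (fun x => v x * Lop sigma mu psi x) = 0.

Section Mollified.
Variable lam : R.
Hypothesis lam0 : 0 < lam.
Local Notation A := (lam^-1 + 1).
Local Notation rho := (molli lam).
Local Notation s_ i := (col i sigma)^T.

Let intw := integrable_levy_weight hlevy.

Let measurable_second_diff x : measurable_fun setT
  (fun p : B * B => second_diff (rho x [::]) p.1 p.2).
Proof.
have mr (f : B * B -> B) : measurable_fun setT f ->
    measurable_fun setT (fun p => rho x [::] (f p)).
  exact: (measurableT_comp (continuous_measurable_rV (@molli_continuous R N lam x [::]))).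
apply: measurable_funB.
  apply: measurable_funD.
    by apply: mr; apply: measurable_addr.
  by apply: mr; apply: measurable_addr => //; exact: measurable_oppr.
by apply: measurable_funM; [exact: measurable_cst|exact: mr].
Qed.

Let integrable_second_diff x y :
  mu.-integrable setT (EFin \o (fun z : B => second_diff (rho x [::]) z y)).
Proof.
have [K K0 HK] := @second_diff_le_cubes R N lam lam0.
apply: (le_integrable measurableT _ _ (integrableZl measurableT (K * 3) intw)).
  apply/measurable_EFinP.
  apply: (measurableT_comp (measurable_second_diff x) (g := fun z : B => ((z, y) : B * B))).
  exact: measurable_fun_pair.
move=> z _ /=; rewrite lee_fin; apply: le_trans (HK x z y) _.
apply: le_trans _ (ler_norm _).
rewrite mulrAC ler_wpM2r ?levy_weight_ge0// ler_wpM2l//.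
exact: (cubes_le _ _ [:: x; x - z; x + z]).
Qed.

Let S x := intRN (fun y => \sum_(i < P) v y * dmolli lam x (s_ i) 2 [::] y).

Let g (x z y : V) := 2^-1 * (v y * second_diff (rho x [::]) z y).

Let measurable_g x : measurable_fun setT (fun p : B * B => g x p.1 p.2).
Proof.
apply: measurable_funM; first exact: measurable_cst.
apply: measurable_funM => //.
apply: (measurableT_comp (continuous_measurable_rV _)) => //; by case: C0v.
Qed.

Let g_le x : exists2 C, 0 <= C & forall z y : V,
  `|g x z y| <= C * levy_weight z * cubes A 0 [:: x; x - z; x + z] y.
Proof.
have [M M0 HM] := C0_bounded C0v.
have [K K0 HK] := @second_diff_le_cubes R N lam lam0.
exists (M * K); first exact: mulr_ge0.
move=> z y; rewrite /g normrM normrM -!mulrA.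
have H : `|v y| * `|second_diff (rho x [::]) z y| <=
    M * (K * (levy_weight z * cubes A 0 [:: x; x - z; x + z] y)).
  by apply: ler_pM => //; rewrite !mulrA; exact: HK.
apply: le_trans H; rewrite ger0_norm// ler_piMl ?mulr_ge0//; lra.
Qed.

Let iint_g x z : iint N (g x z) 0 = 2^-1 * second_diff (mollify lam v) z x.
Proof.
rewrite -(intRN_second_diff lam0 C0v) /intRN.
by rewrite -(iintZ (halfwidth_gt0 lam0) _ _ (leqnn N) (dominated_second_diff lam0 C0v x z)).
Qed.

(** The test function is the bump centred at x. Integrability comes with the identity, from the same
    domination, because the maximum principle compares integrals of second differences. *)
Let equation x : S x + \int[mu]_z (2^-1 * second_diff (mollify lam v) z x) = 0 /\
  mu.-integrable setT (EFin \o (fun z : B => 2^-1 * second_diff (mollify lam v) z x)).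
Proof.
have [C C0' HC] := g_le x.
have A0 := halfwidth_gt0 lam0.
pose cs (z : B) : seq V := [:: x; x - z; x + z].
have w0 (z : B) : 0 <= levy_weight (z : V) by exact: levy_weight_ge0.
have sz z : (size (cs z) <= 3)%N by [].
have I := integrable_iint_param (cs := cs) A0 C0' w0 intw sz (measurable_g x) HC 0 (leqnn N).
split; last by move: I; congr (_.-integrable _ _); apply/funext => z /=; rewrite iint_g.
have D : dominated A (fun y => \sum_(i < P) v y * dmolli lam x (s_ i) 2 [::] y).
  by apply: dominated_sum => i; exact: (dominated_dmolli lam0 C0v).
have F := iint_Fubini (cs := cs) A0 C0' w0 intw sz (measurable_g x) HC 0 (leqnn N) D.
rewrite -[RHS](hdist (molli_Cc_inf lam0 x)) /S /intRN.
under eq_Rintegral => z _ do rewrite -iint_g.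
rewrite -F; congr (iint N _ 0); apply/funext => y.
rewrite /Lop (Lmu_molli hsym hlevy lam0) mulrDr /Lsigma mulr_sumr; congr (_ + _).
  by apply: eq_bigr => i _; rewrite derive2_molli.
rewrite /g RintegralZl//; last exact: (integrableZl measurableT (v y) (integrable_second_diff x y)).
by rewrite RintegralZl//; ring.
Qed.

Lemma mollify_eq0 : sigma != 0 \/ 0 < \int[mu]_z levy_weight z ->
  forall x, mollify lam v x = 0.
Proof.
move=> nontriv.
have C0u := mollify_C0 lam0 C0v.
have intu x : mu.-integrable setT (EFin \o (fun z : B => second_diff (mollify lam v) z x)).
  have [_ /(integrableZl measurableT 2)] := equation x.
  congr (_.-integrable _ _); apply/funext => z /=; rewrite -EFinM; congr EFin; by field.
have uS x : S x + 2^-1 * \int[mu]_z second_diff (mollify lam v) z x = 0.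
  by rewrite -RintegralZl//; have [] := equation x.
have Sloc := second_diff_local lam0 C0v sigma.
have u_le x : mollify lam v x <= 0.
  exact: (max_principle intw nontriv C0u intu uS Sloc).
(* By linearity -u solves the same equation with -S as local part; the maximum principle therefore
   takes S as an abstract function. *)
pose u' x := - mollify lam v x.
have sdN z x : second_diff u' z x = - second_diff (mollify lam v) z x.
  by rewrite /second_diff /u'; ring.
have u_ge x : u' x <= 0.
  have C0u' : C0 u'.
    split; first by move=> y; apply: (@continuousN _ _ _ (mollify lam v)); exact: C0u.1.
    by move=> e /C0u.2[M HM]; exists M => y /HM; rewrite normrN.
  have intu' y : mu.-integrable setT (EFin \o (fun z : B => second_diff u' z y)).
    have := integrableZl measurableT (-1) (intu y).
    by congr (_.-integrable _ _); apply/funext => z /=; rewrite sdN -EFinM mulN1r.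
  have uS' y : - S y + 2^-1 * \int[mu]_z second_diff u' z y = 0.
    under eq_Rintegral => z _ do rewrite sdN -mulN1r.
    by rewrite RintegralZl//; have := uS y; lra.
  apply: (max_principle intw nontriv C0u' intu' uS').
  have [C [h0 [C00 h00 Hh]]] := Sloc; exists C, h0; split => // y h /Hh => /(_ y).
  rewrite -normrN; congr (`|_| <= _).
  rewrite opprB mulrN opprK addrC; congr (_ + _).
  by rewrite -sumrN; apply: eq_bigr => i _; rewrite sdN.
move=> x; apply/eqP; rewrite eq_le u_le /=; have := u_ge x; rewrite /u'; lra.
Qed.

End Mollified.

(** If v x != 0, a narrow bump sees only points where v x * v y >= v x ^ 2 / 2. Multiplying by v x
    treats both signs at once and bounds v x * u x below by the positive integral of a multiple of a
    small cube. *)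
Lemma eq0_of_mollify : (forall lam x, 0 < lam -> mollify lam v x = 0) ->
  forall x, v x = 0.
Proof.
move=> v0 x; apply/eqP; apply: contraT => vx.
have [r r0 Hr] : exists2 r, 0 < r & forall y : V, (forall i, `|y ord0 i - x ord0 i| < r) ->
    v x ^+ 2 / 2 <= v x * v y.
  have /(@cvgrPdist_le _ _ _ (nbhs (x : V)) (nbhs_filter x)) := C0v.1 x.
  move=> /(_ (`|v x| / 2)); rewrite divr_gt0 ?normr_gt0// => /(_ isT).
  move=> /nbhs_ballP[r /= r0 Hr]; exists r => // y Hy.
  have /Hr /= : ball x r y.
    by split => // i j; rewrite ord1 /ball /= distrC; exact: Hy.
  move=> vy.
  have : v x * (v x - v y) <= `|v x| * (`|v x| / 2).
    apply: le_trans (ler_norm _) _; rewrite normrM; exact: ler_wpM2l.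
  by rewrite mulrA -expr2 real_normK ?num_real//; lra.
(* The bump is then supported in the cube of half-width r, and it is at least exp(-2)^N on the cube
   of half-width A' = r / 2. *)
pose lam := r^-1.
have lam0 : 0 < lam by rewrite invr_gt0.
have A0 := halfwidth_gt0 lam0.
pose A' := (2 * lam)^-1.
have A'0 : 0 < A' by rewrite invr_gt0 mulr_gt0.
pose c := v x ^+ 2 / 2 * expR (-2) ^+ N.
have v2 : 0 < v x ^+ 2 / 2 by rewrite divr_gt0// exprn_even_gt0.
have c0 : 0 < c by rewrite mulr_gt0// exprn_gt0// expR_gt0.
have D1 := dominatedZ (v x) (dominated_mollify lam0 C0v x).
have A'A : A' <= lam^-1 + 1.
  rewrite /A' invfM; have : 0 < lam^-1 by rewrite invr_gt0.
  lra.
have Dc : dominated (lam^-1 + 1) (cube A' 0 x).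
  split.
    apply: measurable_prod => i _.
    have mI : measurable_fun setT (\1_(`[x ord0 i - A', x ord0 i + A']) : R -> R).
      exact: measurable_indic.
    exact: (measurableT_comp mI (measurable_coord i)).
  exists 1, [:: x]; split => // y; rewrite mul1r cubes1.
  rewrite ger0_norm ?cube_ge0//.
  have [H|[i Hi]] := cube_dec A' x y.
    rewrite [leRHS]cube_in ?cube_le1// => i; exact: le_trans (H i) A'A.
  rewrite [leLHS](_ : _ = 0) ?cube_ge0//.
  apply/eqP; rewrite prodf_seq_eq0; apply/hasP; exists i; first exact: mem_index_enum.
  rewrite /= indicE memNset// => /=; rewrite in_itv /= -ler_distlC distrC leNgt Hi//.
have D2 := dominatedZ c Dc.
have := le_iint A0 0 (leqnn N) D2 D1.
rewrite (iintZ A0 _ _ (leqnn N) (dominated_mollify lam0 C0v x)).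
rewrite (_ : iint N (fun y => v y * molli lam x [::] y) 0 = 0) ?mulr0; last exact: v0.
rewrite (iintZ A0 _ _ (leqnn N) Dc) (iint_cube A'0)//.
rewrite (_ : cube A' N x 0 = 1); last first.
  by rewrite /cube big1// => i; rewrite leqNgt ltn_ord.
have W0 : 0 < c * ((2 * A') ^+ N * 1) by rewrite mulr1 mulr_gt0// exprn_gt0// mulr_gt0.
move=> H; suff : c * ((2 * A') ^+ N * 1) <= 0 by rewrite leNgt W0.
apply: H => y; rewrite mulrA.
have [H|[i Hi]] := cube_dec A' x y.
  rewrite cube_in// mulr1 /c; apply: ler_pM; rewrite ?(ltW v2) ?exprn_ge0 ?expR_ge0//.
    apply: Hr => i; apply: le_lt_trans (H i) _.
    by rewrite /A' invfM invrK; lra.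
  exact: (molli_gt lam0).
rewrite [leLHS](_ : _ = 0); last first.
  suff -> : cube A' 0 x y = 0 by rewrite mulr0.
  apply/eqP; rewrite prodf_seq_eq0; apply/hasP; exists i; first exact: mem_index_enum.
  rewrite /= indicE memNset// => /=; rewrite in_itv /= -ler_distlC distrC leNgt Hi//.
(* Between the small cube and the edge of the support v x * v y is still positive; further out the
   bump vanishes. *)
have [/forallP H|/forallPn[j]] := boolP [forall i, `|y ord0 i - x ord0 i| < r].
  by rewrite mulr_ge0 ?molli_ge0// (le_trans (ltW v2))// Hr.
rewrite -leNgt => Hj; have Hj' : lam^-1 <= `|y ord0 j - x ord0 j| by rewrite invrK.
by rewrite (molli_supp lam0 [::] Hj') mulr0.
Qed.

End Liouville.

(** * From a nonempty support to a positive Levy mass *)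

Section Support.
Context {R : realType} {N : nat}.
Local Notation V := 'rV[R]_N.
Local Notation B := (borelRV R N).
Variable mu : {measure set B -> \bar R}.
Hypothesis hlevy : (\int[mu]_(z in ~` [set (0%R : V)])
  (Num.min (enorm z ^+ 2) 1)%R%:E < +oo)%E.

(** A zero integral makes the weight vanish almost everywhere; being positive off the origin, it
    makes the complement of 0 a null set. But that complement is an open neighbourhood of any point
    of the support. *)
Lemma integral_levy_weight_gt0 : msupport mu !=set0 -> 0 < \int[mu]_z levy_weight z.
Proof.
move=> [x [x0 Hx]]; rewrite lt_neqAle Rintegral_ge0 ?andbT; last first.
  by move=> z _; exact: levy_weight_ge0.
have intw := integrable_levy_weight hlevy.
apply/negP => /eqP I0.
have E0 : (\int[mu]_z `|(levy_weight z)%:E| = 0)%E.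
  under eq_integral => z _ do rewrite gee0_abs ?lee_fin ?levy_weight_ge0//.
  by rewrite -(fineK (integrable_fin_num measurableT intw)); congr EFin.
have mw : measurable_fun setT (EFin \o (levy_weight : B -> R)).
  by apply/measurable_EFinP; exact: measurable_levy_weight.
have /(ae_eq_integral_abs mu measurableT mw)[C [mC C0 HC]] := E0.
have xD : (~` [set (0 : V)]) x by move=> /= x00; rewrite x00 eqxx in x0.
have := Hx _ (@open_setC0 R N) xD; apply/negP; rewrite -leNgt -C0.
apply: le_measure; rewrite ?inE//; first exact: measurable_setC0.
apply: subset_trans HC => z /= z0 /(_ I) [].
have := levy_weight_gt0 (z := z); move=> /(_ _)/lt0r_neq0 H wz.
have : levy_weight z != 0 by apply: H; apply/eqP.
by rewrite wz eqxx.
Qed.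

End Support.

Section SigmaFiniteCopy.
Context d (T : measurableType d) (R : realType) (mu : {measure set T -> \bar R}).

(* An alias of [mu] on which a sigma-finite structure can be declared. *)
Definition sigma_finite_copy (mu_sf : sigma_finite setT mu) : set T -> \bar R := mu.

Variable mu_sf : sigma_finite setT mu.

HB.instance Definition _ := Measure.copy (sigma_finite_copy mu_sf) mu.

HB.instance Definition _ := Measure_isSigmaFinite.Build _ _ _ (sigma_finite_copy mu_sf) mu_sf.

End SigmaFiniteCopy.

Theorem theorem4 (R : realType) (N P : nat) (sigma : 'M[R]_(N, P))
  (mu : {measure set (borelRV R N) -> \bar R})
  (* mu is a measure on R^N \ {0} *)
  (hmu0 : mu [set (0 : 'rV[R]_N)] = 0%E)
  (* symmetric *)
  (hsym : forall A : set (borelRV R N), measurable A ->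
            mu [set - (z : 'rV[R]_N) | z in A] = mu A)
  (* Radon: finite on compact subsets of R^N \ {0} *)
  (hradon : forall K : set 'rV[R]_N, compact K -> ~ K 0 -> (mu K < +oo)%E)
  (* Levy integrability condition *)
  (hlevy : (\int[mu]_(z in ~` [set (0%R : 'rV[R]_N)])
              (Num.min (enorm z ^+ 2) 1)%R%:E < +oo)%E)
  (hnontriv : sigma != 0 \/ msupport mu !=set0)
  (v : 'rV[R]_N -> R) (hv : C0 v)
  (hdist : forall psi : 'rV[R]_N -> R, Cc_inf psi ->
             intRN (fun x => v x * Lop sigma mu psi x) = 0) :
  forall x : 'rV[R]_N, v x = 0.
Proof.
(* Fubini with the Lebesgue measure asks for a sigma-finite structure on mu, which the Levy
   condition and the null origin supply. *)
have [mus musE] : exists mus : {sigma_finite_measure set (borelRV R N) -> \bar R},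
    mu = mus :> {measure set (borelRV R N) -> \bar R}.
  exists (sigma_finite_copy (levy_sigma_finite hmu0 hlevy)).
  exact: eq_measure.
subst mu.
have nontriv : sigma != 0 \/ 0 < \int[mus]_z levy_weight z.
  by case: hnontriv => [?|]; [left|right; exact: integral_levy_weight_gt0].
apply: (eq0_of_mollify hv) => lam y lam0.
exact: (mollify_eq0 hsym hlevy hv hdist lam0 nontriv).
Qed.
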